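(* Let $\varphi:S\times S\to\mathbb{R}$ be a non-constant function. For any $\alpha\in[P'(-\infty),P'(+\infty)]$, we have $$\dim E(\alpha)=\frac{1}{2\log m}\left(P(s_\alpha)-s_\alpha P'(s_\alpha)\right),$$ where $s_\alpha$ is the unique solution of $P'(s)=\alpha$; for the endpoints $\alpha=P'(-\infty)$ and $\alpha=P'(+\infty)$ one takes $s_\alpha=-\infty$ and $s_\alpha=+\infty$ respectively, and the right-hand side is understood as the limit of $\frac{1}{2\log m}(P(s)-sP'(s))$ as $s\to-\infty$, respectively $s\to+\infty$.
   Context: Let $m\ge 2$ be an integer, $S=\{0,1,\dots,m-1\}$, and $\Sigma_m=S^{\mathbb{N}}$ the space of sequences $x=(x_1,x_2,\dots)$ with entries in $S$. The metric on $\Sigma_m$ is $d(x,y)=m^{-n}$, where $n$ is the largest $k\ge 0$ such that $x_1=y_1,\dots,x_k=y_k$ (and $d(x,x)=0$). For a set $A\subset\Sigma_m$, $\dim A$ denotes its Hausdorff dimension. For $\varphi:S\times S\to\mathbb{R}$ and $\alpha\in\mathbb{R}$, define $$E(\alpha)=\left\{x\in\Sigma_m:\ \lim_{n\to\infty}\frac1n\sum_{k=1}^n\varphi(x_k,x_{2k})=\alpha\right\},$$ where it is required that the limit exists. For $s\in\mathbb{R}$, $(t_0(s),\dots,t_{m-1}(s))$ denotes the unique solution with strictly positive components of the system $$t_i^2=\sum_{j=0}^{m-1}e^{s\varphi(i,j)}t_j\qquad(i=0,1,\dots,m-1),$$ and $$P(s)=\log\sum_{j=0}^{m-1}t_j(s).$$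 For non-constant $\varphi$, the function $P$ is analytic and strictly convex on $\mathbb{R}$. $P'(-\infty)$ and $P'(+\infty)$ denote the limits of $P'(s)$ as $s\to-\infty$ and $s\to+\infty$. *)

(* Defs.v *)
From HB Require Import structures.
From mathcomp Require Import all_boot all_order all_algebra.
From mathcomp Require Import all_classical all_reals all_analysis.

Set Implicit Arguments.
Unset Strict Implicit.
Unset Printing Implicit Defensive.

Import Order.TTheory GRing.Theory Num.Theory.
Import numFieldNormedType.Exports.

Local Open Scope classical_set_scope.
Local Open Scope ring_scope.

Section Hausdorff.
Context {R : realType} {T : metricType R}.
Local Open Scope ereal_scope.

(* diam set0 = -oo, so the empty set is allowed in every cover below. *)
Definition diam (U : set T) : \bar R :=
  ereal_sup [set (mdist p.1 p.2)%:E | p in U `*` U].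

(* diam(U)^s, with the conventions diam(set0)^s = 0 and 0^0 = 1, so that the
   0-dimensional Hausdorff measure is the counting measure. *)
Definition diam_pow (s : R) (U : set T) : \bar R :=
  if U == set0 then 0 else poweR (diam U) s.

Definition hausdorff_premeasure (s delta : R) (A : set T) : \bar R :=
  ereal_inf [set \sum_(0 <= i <oo) diam_pow s (U i) | U in
    [set U : nat -> set T |
      A `<=` \bigcup_i U i /\ forall i, diam (U i) <= delta%:E]].

(* The premeasure is nonincreasing in delta: this sup is its limit at 0+. *)
Definition hausdorff_measure (s : R) (A : set T) : \bar R :=
  ereal_sup [set hausdorff_premeasure s delta A | delta in [set e : R | (0 < e)%R]].

Definition hausdorff_dim (A : set T) : \bar R :=
  ereal_inf [set s%:E | s in [set s : R | (0 <= s)%R /\ hausdorff_measure s A = 0]].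

End Hausdorff.

(* R only serves as the codomain of the distance. *)
Definition symbolic_space (R : realType) (m : nat) : Type := nat -> 'I_m.

HB.instance Definition _ (R : realType) (m : nat) :=
  Choice.copy (symbolic_space R m) (nat -> 'I_m).

Section SymbolicSpace.
Context {R : realType} {m : nat}.
Implicit Types x y z : symbolic_space R m.

(* Coordinates are numbered from 1: the entry x_k is x k.-1. *)
Definition entry x (k : nat) : 'I_m := x k.-1.

Definition agree_upto x y (k : nat) : Prop :=
  forall i, (1 <= i <= k)%N -> entry x i = entry y i.

(* The largest k such that x_1 = y_1, ..., x_k = y_k, when x and y differ. *)
Definition common_prefix x y : nat :=
  xget 0%N [set k | agree_upto x y k /\
                    forall l, agree_upto x y l -> (l <= k)%N].

Definition symbolic_dist x y : R :=
  if x == y then 0 else m%:R ^- common_prefix x y.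

Lemma agree_uptoC x y k : agree_upto x y k -> agree_upto y x k.
Proof. by move=> xy i ik; rewrite xy. Qed.

Lemma common_prefixP x y : x != y ->
  agree_upto x y (common_prefix x y) /\
  forall l, agree_upto x y l -> (l <= common_prefix x y)%N.
Proof.
move=> xy.
have ex : exists n, x n != y n.
  apply/not_existsP => nxy; move/eqP: xy; apply; apply/funext => n.
  by have /negP := nxy n; rewrite negbK => /eqP.
rewrite /common_prefix; case: xgetP => [k -> //|none]; exfalso.
case: (ex_minnP ex) => n xyn nmin; apply: (none n); split.
- case=> // i /andP[_ ilt]; rewrite /entry/=.
  apply/eqP; apply: contraT => /nmin; by rewrite leqNgt ilt.
- move=> l xyl; rewrite leqNgt; apply/negP => nl.
  by move: xyn; have := xyl n.+1 nl; rewrite /entry/= => ->; rewrite eqxx.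
Qed.

Lemma common_prefixC x y : x != y -> common_prefix x y = common_prefix y x.
Proof.
move=> xy; have yx : y != x by rewrite eq_sym.
have [a b] := common_prefixP xy; have [c d] := common_prefixP yx.
by apply/eqP; rewrite eqn_leq d ?b//; exact: agree_uptoC.
Qed.

Lemma symbolic_gt0 x : (0 < m%:R :> R) && (1 <= m%:R :> R).
Proof. by rewrite ltr0n ler1n andbb (leq_ltn_trans _ (ltn_ord (x 0%N))). Qed.

Lemma symbolic_dist_ge0 x y : 0 <= symbolic_dist x y.
Proof. by rewrite /symbolic_dist; case: ifP => // _; rewrite invr_ge0 exprn_ge0. Qed.

Lemma symbolic_distxx x : symbolic_dist x x = 0.
Proof. by rewrite /symbolic_dist eqxx. Qed.

Lemma symbolic_dist_eq0 x y : symbolic_dist x y = 0 -> x = y.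
Proof.
rewrite /symbolic_dist; case: eqP => // _ /eqP.
have /andP[m0 _] := symbolic_gt0 x.
by rewrite invr_eq0 expf_eq0 (gt_eqF m0) andbF.
Qed.

Lemma symbolic_distC x y : symbolic_dist x y = symbolic_dist y x.
Proof.
rewrite /symbolic_dist [y == x]eq_sym; case: (eqVneq x y) => // xy.
by rewrite common_prefixC.
Qed.

Lemma symbolic_dist_triangle y x z :
  symbolic_dist x z <= symbolic_dist x y + symbolic_dist y z.
Proof.
have [<-|xz] := eqVneq x z.
  by rewrite symbolic_distxx addr_ge0// symbolic_dist_ge0.
have [<-|xy] := eqVneq x y; first by rewrite symbolic_distxx add0r.
have [<-|yz] := eqVneq y z; first by rewrite symbolic_distxx addr0.
have /andP[m0 m1] := symbolic_gt0 x.
have le_dist k : (k <= common_prefix x z)%N ->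
    symbolic_dist x z <= m%:R ^- k.
  move=> kxz; rewrite /symbolic_dist (negbTE xz).
  by rewrite lef_pV2 ?posrE ?exprn_gt0// ler_weXn2l.
have [axy _] := common_prefixP xy; have [ayz _] := common_prefixP yz.
have [_ mxz] := common_prefixP xz.
have [le|/ltnW le] := leqP (common_prefix x y) (common_prefix y z).
- apply: (@le_trans _ _ (symbolic_dist x y)); last first.
    by rewrite lerDl symbolic_dist_ge0.
  rewrite [leRHS]/symbolic_dist (negbTE xy); apply/le_dist/mxz => i /andP[i1 ik].
  by rewrite axy ?i1// ayz// i1 (leq_trans ik).
- apply: (@le_trans _ _ (symbolic_dist y z)); last first.
    by rewrite lerDr symbolic_dist_ge0.
  rewrite [leRHS]/symbolic_dist (negbTE yz); apply/le_dist/mxz => i /andP[i1 ik].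
  by rewrite axy ?ayz ?i1// (leq_trans ik).
Qed.

End SymbolicSpace.

HB.instance Definition _ (R : realType) (m : nat) :=
  isMetric.Build R (symbolic_space R m) symbolic_distxx symbolic_dist_eq0
    symbolic_distC symbolic_dist_triangle.

Section Multifractal.
Context {R : realType} {m : nat}.
Variable phi : 'I_m -> 'I_m -> R.

Definition level_set (alpha : R) : set (symbolic_space R m) :=
  [set x | n%:R^-1 * \sum_(1 <= k < n.+1) phi (entry x k) (entry x (2 * k))
             @[n --> \oo] --> alpha].

Definition transfer_system (s : R) (t : 'I_m -> R) : Prop :=
  (forall i, 0 < t i) /\
  (forall i, t i ^+ 2 = \sum_(j < m) expR (s * phi i j) * t j).

(* The default value is never used: the system has a unique positive solution. *)
Definition transfer_solution (s : R) : 'I_m -> R :=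
  xget (fun=> 0) [set t | transfer_system s t].

Definition pressure (s : R) : R := ln (\sum_(j < m) transfer_solution s j).

Definition dpressure : R -> R := derive1 pressure.

Definition dpressure_ninfty : R := lim (dpressure s @[s --> -oo]).

Definition dpressure_pinfty : R := lim (dpressure s @[s --> +oo]).

Definition dim_formula (s : R) : R :=
  (2 * ln m%:R)^-1 * (pressure s - s * dpressure s).

End Multifractal.

(* Main.v *)
Require Import Defs.
From mathcomp Require Import all_boot all_order all_algebra.
From mathcomp Require Import all_classical all_reals all_analysis.
From mathcomp Require Import zify ring lra.

Set Implicit Arguments.
Unset Strict Implicit.
Unset Printing Implicit Defensive.

Import Order.TTheory GRing.Theory Num.Theory.
Import numFieldNormedType.Exports.

Local Open Scope classical_set_scope.
Local Open Scope ring_scope.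

(** The positive integers split into the chains [i, 2i, 4i, ...] with [i] odd,
    and [phi (x_k) (x_2k)] only couples neighbours on a chain.  For a parameter
    [s] let the entries along each chain form, independently of the other
    chains, a Markov chain with initial law [t_j / sum t] and transition
    probabilities [e^(s phi(i,j)) t_j / t_i^2]; the transfer system says
    exactly that these are probabilities.  The mass of the cylinder of the
    first [2k] entries of [x] then telescopes ([transfer_mass]) to
      [exp (s S_k - k P(s) + L_2k - 2 L_k)],
    where [S_k] is the sum of [phi (x_l) (x_2l)] and [L_k] that of [ln t(x_l)],
    over [l <= k].

    Upper bound ([level_set_dim_le]).  If [L_2k - 2 L_k] were below [- eta k]
    for all large [k], then [L_k / k] would be unbounded.  Hence on the level
    set of [alpha] infinitely many cylinders around each point have mass at
    least about [exp (- k (P(s) - s alpha))], and covering by such cylinders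
    bounds the dimension by [(P(s) - s alpha) / (2 ln m)], for every [s] at which
    this is nonnegative.

    Lower bound ([level_set_dim_ge]).  For an arbitrary initial law and
    transition matrix the frequencies of the symbols and of the pairs
    [(x_k, x_2k)] obey a law of large numbers, so that almost every point lies
    in one level set and has local dimension [entropy / ln m].  The argument
    stays with finite words: an expectation operator integrates out one entry
    after the other, an exponential moment bound controls the martingales
    behind the law of large numbers, and compactness shows that cylinders
    covering the set of typical points have total mass at least [1/2].  The
    mass distribution principle needs no more.

    The two bounds meet because [P'(s)] is the mean of [phi] for the Gibbs chain
    of parameter [s].  Jensen's inequality makes this mean a subgradient of [P]
    ([pressure_subgradient]), strictly when [phi] is not constant, and it is
    continuous in [s]; so it is the derivative, it is strictly increasing, and
    the entropy of the Gibbs chain is [(P(s) - s P'(s)) / 2].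

    At an end of the spectrum the Gibbs chains are followed along an
    ultrafilter ([level_set_dim_cvg]).  Their limit is a chain to which the
    lower bound still applies, while the upper bound holds along the way. *)

(** * Words weighted by a Markov chain along the doubling map *)

Section DoublingChain.
Context {R : realType} {m : nat}.
Local Notation seqs := (symbolic_space R m).
Implicit Types (x y z : seqs) (G H : seqs -> R).

Definition stochastic (pi : 'I_m -> R) (p : 'I_m -> 'I_m -> R) : Prop :=
  [/\ forall i, 0 <= pi i, \sum_i pi i = 1,
      forall i j, 0 <= p i j & forall i, \sum_j p i j = 1].

Definition adapted (n : nat) G : Prop :=
  forall x y, agree_upto x y n -> G x = G y.

Definition upd x (k : nat) (j : 'I_m) : seqs :=
  fun i => if i == k.-1 then j else x i.

Lemma agree_upto_le x y n k : (k <= n)%N -> agree_upto x y n -> agree_upto x y k.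
Proof. by move=> kn xy i /andP[i1 ik]; apply: xy; rewrite i1 (leq_trans ik). Qed.

Lemma agree_upto_trans y x z n :
  agree_upto x y n -> agree_upto y z n -> agree_upto x z n.
Proof. by move=> xy yz i ik; rewrite xy// yz. Qed.

Lemma entry_upd x k j : entry (upd x k j) k = j.
Proof. by rewrite /entry /upd eqxx. Qed.

Lemma upd_agree x k j n : (n < k)%N -> agree_upto (upd x k j) x n.
Proof.
move=> nk i /andP[i1 ile]; rewrite /entry /upd ifN//.
by apply/eqP; lia.
Qed.

Lemma agree_uptoS x y n : agree_upto x y n.+1 <->
  agree_upto x y n /\ entry x n.+1 = entry y n.+1.
Proof.
split=> [xy|[xy e] i /andP[i1]].
  by split; [exact: agree_upto_le xy|apply: xy; rewrite /= leqnn].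
by rewrite leq_eqVlt => /predU1P[->//|ilt]; apply: xy; rewrite i1.
Qed.

Lemma adapted_le n k G : (n <= k)%N -> adapted n G -> adapted k G.
Proof. by move=> nk aG x y xy; apply: aG; exact: agree_upto_le xy. Qed.

Section Chain.
Variables (pi : 'I_m -> R) (p : 'I_m -> 'I_m -> R).

(** The conditional law of the [k]-th entry: odd indices start a new chain
    [k, 2k, 4k, ...], an even index continues the chain of its half. *)
Definition step (k : nat) x (j : 'I_m) : R :=
  if odd k then pi j else p (entry x k./2) j.

Definition mass (n : nat) x : R := \prod_(1 <= k < n.+1) step k x (entry x k).

Definition avg (k : nat) G x : R := \sum_j step k x j * G (upd x k j).

(** Integration of the first [n] entries, the last one first: on functions of
    these entries, the integral against the telescopic product measure. *)
Fixpoint expect (n : nat) G : seqs -> R :=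
  if n is n'.+1 then expect n' (avg n'.+1 G) else G.

Lemma step_agree k x y j : (0 < k)%N -> agree_upto x y k.-1 ->
  step k x j = step k y j.
Proof.
move=> k0 xy; rewrite /step; case: ifPn => // ek; rewrite xy//.
by lia.
Qed.

Lemma massS n x : mass n.+1 x = mass n x * step n.+1 x (entry x n.+1).
Proof. by rewrite /mass big_nat_recr. Qed.

Lemma mass0 x : mass 0 x = 1.
Proof. by rewrite /mass big_geq. Qed.

Lemma mass_agree n x y : agree_upto x y n -> mass n x = mass n y.
Proof.
elim: n => [|n IH]; first by rewrite !mass0.
move=> /agree_uptoS[xy e]; rewrite !massS IH// e; congr (_ * _).
exact: step_agree.
Qed.

Lemma avg_sum (I : finType) k (G : I -> seqs -> R) x :
  avg k (fun y => \sum_i G i y) x = \sum_i avg k (G i) x.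
Proof.
rewrite /avg exchange_big; apply: eq_bigr => j _.
by rewrite mulr_sumr.
Qed.

Lemma avgD k G H x : avg k (fun y => G y + H y) x = avg k G x + avg k H x.
Proof. by rewrite /avg -big_split; apply: eq_bigr => j _; rewrite mulrDr. Qed.

Lemma avg_pull k G H x : (0 < k)%N -> adapted k.-1 G ->
  avg k (fun y => G y * H y) x = G x * avg k H x.
Proof.
move=> k0 aG; rewrite /avg mulr_sumr; apply: eq_bigr => j _.
rewrite mulrCA; congr (_ * _); apply: aG; apply: upd_agree.
by rewrite ltn_predL.
Qed.

Lemma expectD n G H x :
  expect n (fun y => G y + H y) x = expect n G x + expect n H x.
Proof.
elim: n G H => //= n IH G H; rewrite -IH; congr (expect n _ x).
by apply/funext => y; rewrite avgD.
Qed.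

Lemma expect_sum (I : finType) n (G : I -> seqs -> R) x :
  expect n (fun y => \sum_i G i y) x = \sum_i expect n (G i) x.
Proof.
elim: n G => //= n IH G; rewrite -IH; congr (expect n _ x).
by apply/funext => y; rewrite avg_sum.
Qed.

Lemma expectZ n c G x : expect n (fun y => c * G y) x = c * expect n G x.
Proof.
elim: n G => //= n IH G; rewrite -IH; congr (expect n _ x).
by apply/funext => y; rewrite avg_pull// => ? ?.
Qed.

Lemma expect_cylinder n z x :
  expect n (fun y => (`[< agree_upto y z n >])%:R) x = mass n z.
Proof.
elim: n => [|n IH] /=.
  by rewrite mass0 asboolT// => i; rewrite leqn0; case: i.
rewrite massS -IH mulrC -expectZ; congr (expect n _ x); apply/funext => y.
rewrite /avg (bigD1 (entry z n.+1))//= big1 ?addr0 => [|j jz].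
  have [yz|yz] := pselect (agree_upto y z n).
    rewrite (@step_agree n.+1 y z (entry z n.+1) isT yz).
    rewrite (asboolT yz) asboolT// agree_uptoS entry_upd; split => //.
    exact: agree_upto_trans (upd_agree _ _ _) yz.
  rewrite (asboolF yz) mulr0 asboolF ?mulr0// agree_uptoS => -[uz _]; apply: yz.
  by apply: agree_upto_trans uz; exact/agree_uptoC/upd_agree.
rewrite asboolF ?mulr0// agree_uptoS entry_upd => -[_ /eqP].
by rewrite (negbTE jz).
Qed.

Hypothesis st : stochastic pi p.

Lemma step_ge0 k x j : 0 <= step k x j.
Proof. by case: st => a _ b _; rewrite /step; case: ifP. Qed.

Lemma step_sum1 k x : \sum_j step k x j = 1.
Proof. by case: st => _ a _ b; rewrite /step; case: (odd k). Qed.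

Lemma mass_ge0 n x : 0 <= mass n x.
Proof. by apply: prodr_ge0 => i _; exact: step_ge0. Qed.

Lemma avg_le k G H x : (forall y, G y <= H y) -> avg k G x <= avg k H x.
Proof. by move=> GH; apply: ler_sum => j _; rewrite ler_wpM2l// step_ge0. Qed.

Lemma avg_id k G x : (0 < k)%N -> adapted k.-1 G -> avg k G x = G x.
Proof.
move=> k0 aG; transitivity (avg k (fun y => G y * 1) x).
  by congr avg; apply/funext => y; rewrite mulr1.
rewrite avg_pull// -[RHS]mulr1; congr (_ * _).
by rewrite -[RHS](step_sum1 k x); apply: eq_bigr => j _; rewrite mulr1.
Qed.

Lemma expect_le n G H x : (forall y, G y <= H y) -> expect n G x <= expect n H x.
Proof.
by elim: n G H => //= n IH G H GH; apply: IH => y; exact: avg_le.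
Qed.

Lemma expect_adapted n N G x : (n <= N)%N -> adapted n G ->
  expect N G x = expect n G x.
Proof.
move=> /subnKC <- aG; elim: (N - n)%N => [|k IH]; first by rewrite addn0.
rewrite addnS /= -IH; congr expect; apply/funext => y.
by apply: avg_id => //; apply: adapted_le aG; rewrite leq_addr.
Qed.

Lemma expect_cst n c x : expect n (fun=> c) x = c.
Proof. by rewrite (@expect_adapted 0). Qed.

Section Score.
Variables (a : 'I_m -> R) (b : 'I_m -> 'I_m -> R).

(** The pairs [(a, b)] of interest are: indicators of a symbol, whose score
    counts visits; [(0, phi)], whose score is the sum defining level sets; and
    [(ln pi, ln p)], whose score is the logarithm of the mass. *)
Definition gain (k : nat) x (j : 'I_m) : R :=
  if odd k then a j else b (entry x k./2) j.

Definition drift (k : nat) x : R := \sum_j step k x j * gain k x j.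

Definition score (n : nat) x : R := \sum_(1 <= k < n.+1) gain k x (entry x k).

Definition compensator (n : nat) x : R := \sum_(1 <= k < n.+1) drift k x.

Definition martingale (n : nat) x : R := score n x - compensator n x.

Lemma gain_agree k x y j : (0 < k)%N -> agree_upto x y k.-1 ->
  gain k x j = gain k y j.
Proof.
move=> k0 xy; rewrite /gain; case: ifPn => // ek; rewrite xy//.
by lia.
Qed.

Lemma drift_agree k x y : (0 < k)%N -> agree_upto x y k.-1 ->
  drift k x = drift k y.
Proof.
move=> k0 xy; apply: eq_bigr => j _.
by rewrite (step_agree _ k0 xy) (gain_agree _ k0 xy).
Qed.

Lemma scoreS n x : score n.+1 x = score n x + gain n.+1 x (entry x n.+1).
Proof. by rewrite /score big_nat_recr. Qed.

Lemma compensatorS n x : compensator n.+1 x = compensator n x + drift n.+1 x.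
Proof. by rewrite /compensator big_nat_recr. Qed.

Lemma martingaleS n x : martingale n.+1 x =
  martingale n x + (gain n.+1 x (entry x n.+1) - drift n.+1 x).
Proof. by rewrite /martingale scoreS compensatorS; ring. Qed.

Lemma martingale_adapted n : adapted n (martingale n).
Proof.
elim: n => [|n IH] x y.
  by rewrite /martingale /score /compensator !big_geq.
move=> /agree_uptoS[xy e]; rewrite !martingaleS (IH x y)// e.
by rewrite (@gain_agree _ x y)// (@drift_agree _ x y).
Qed.

(** Square [1 - t / 2 <= e^(- t / 2)] and invert. *)
Lemma expR_le_quadratic (t : R) : t <= 1 -> expR t <= 1 + t + 2 * t ^+ 2.
Proof.
move=> t1; have h : 1 - t / 2 <= expR (- (t / 2)) by exact: expR_ge1Dx.
have e0 := expR_gt0 (- (t / 2)).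
have E : expR t * expR (- (t / 2)) ^+ 2 = 1.
  by rewrite -expRM_natl -expRD -expR0; congr expR; field.
set u := expR _ in h e0 E; have u2 : (1 - t / 2) ^+ 2 <= u ^+ 2.
  by rewrite lerXn2r// ?nnegrE; lra.
rewrite -(ler_pM2r (_ : 0 < u ^+ 2)) ?exprn_gt0// E.
apply: (@le_trans _ _ ((1 + t + 2 * t ^+ 2) * (1 - t / 2) ^+ 2)).
  have -> : (1 + t + 2 * t ^+ 2) * (1 - t / 2) ^+ 2 =
    1 + t ^+ 2 * ((1 - t) * (5 / 2 - t) / 2) by field.
  rewrite lerDl mulr_ge0 ?sqr_ge0// divr_ge0// mulr_ge0//; lra.
by rewrite ler_wpM2l//; nra.
Qed.

Variable C : R.
Hypothesis aC : forall j, `|a j| <= C.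
Hypothesis bC : forall i j, `|b i j| <= C.

Lemma gain_bound k x j : `|gain k x j| <= C.
Proof. by rewrite /gain; case: ifP. Qed.

Lemma drift_bound k x : `|drift k x| <= C.
Proof.
apply: le_trans (ler_norm_sum _ _ _) _.
rewrite -[leRHS]mul1r -(step_sum1 k x) mulr_suml; apply: ler_sum => j _.
by rewrite normrM (ger0_norm (step_ge0 _ _ _)) ler_wpM2l ?step_ge0 ?gain_bound.
Qed.

(** Given the past, an increment is centred and bounded by [2C], so each entry
    multiplies the exponential moment by at most [1 + 8 l^2 C^2]. *)
Lemma expect_exp_martingale l n x : `|l| * (2 * C) <= 1 ->
  expect n (fun y => expR (l * martingale n y)) x
    <= expR (8 * l ^+ 2 * C ^+ 2 * n%:R).
Proof.
move=> lC; elim: n => [|n IH] /=.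
  by rewrite /martingale /score /compensator !big_geq// subr0 !mulr0.
have -> : expR (8 * l ^+ 2 * C ^+ 2 * n.+1%:R) =
    expR (8 * l ^+ 2 * C ^+ 2) * expR (8 * l ^+ 2 * C ^+ 2 * n%:R).
  by rewrite -expRD -natr1; congr expR; ring.
apply: le_trans (ler_wpM2l (expR_ge0 _) IH).
rewrite -expectZ; apply: expect_le => y.
have -> : avg n.+1 (fun z => expR (l * martingale n.+1 z)) y =
    avg n.+1 (fun z => expR (l * martingale n z) *
      expR (l * (gain n.+1 z (entry z n.+1) - drift n.+1 z))) y.
  by congr avg; apply/funext => z; rewrite martingaleS mulrDr expRD.
rewrite avg_pull//; last by move=> u v uv; rewrite (martingale_adapted uv).
rewrite mulrC ler_wpM2r ?expR_ge0//.
pose D j := l * (gain n.+1 y j - drift n.+1 y).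
have D1 j : `|D j| <= `|l| * (2 * C).
  rewrite normrM ler_wpM2l// (le_trans (ler_normB _ _))// mulr_natl mulr2n.
  by rewrite lerD ?gain_bound ?drift_bound.
have -> : avg n.+1 (fun z => expR (l * (gain n.+1 z (entry z n.+1) - drift n.+1 z))) y
    = \sum_j step n.+1 y j * expR (D j).
  apply: eq_bigr => j _; rewrite entry_upd.
  by rewrite (@gain_agree _ _ y)// ?(@drift_agree _ _ y)//; exact: upd_agree.
apply: (@le_trans _ _ (1 + 8 * l ^+ 2 * C ^+ 2)); last exact: expR_ge1Dx.
apply: (@le_trans _ _ (\sum_j step n.+1 y j * (1 + D j + 8 * l ^+ 2 * C ^+ 2))).
  apply: ler_sum => j _; rewrite ler_wpM2l ?step_ge0//.
  apply: (le_trans (expR_le_quadratic _)).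
    exact: le_trans (ler_norm _) (le_trans (D1 j) lC).
  rewrite lerD2l; have -> : 8 * l ^+ 2 * C ^+ 2 = 2 * (`|l| * (2 * C)) ^+ 2.
    by rewrite !exprMn real_normK ?num_real//; ring.
  rewrite ler_pM2l// -(real_normK (num_real (D j))) lerXn2r ?nnegrE//.
  exact: le_trans (D1 j).
under eq_bigr do rewrite mulrDr mulrDr mulr1.
rewrite 2!big_split /= step_sum1 -mulr_suml step_sum1 mul1r.
have -> : \sum_j step n.+1 y j * D j = 0.
  rewrite /D; under eq_bigr do rewrite mulrCA mulrBr.
  rewrite -mulr_sumr sumrB -mulr_suml step_sum1 mul1r.
  by rewrite /drift subrr mulr0.
by rewrite addr0.
Qed.

End Score.
End Chain.
End DoublingChain.

(** * Compactness of the sequence space and sets carrying mass *)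

Section TypicalSet.
Context {R : realType} {m : nat}.
Local Notation seqs := (symbolic_space R m).
Implicit Types (x y z : seqs).

(** A cylinder without finite subcover contains, one letter further, another
    one; the point in the intersection of such a sequence of cylinders lies in
    some [G k], hence so does one of these cylinders. *)
Lemma finite_subcover (G : nat -> set seqs) (L : nat -> nat) :
  (forall k x y, agree_upto x y (L k) -> G k x -> G k y) ->
  (forall x, exists k, G k x) ->
  exists N, forall x, exists2 k, (k < N)%N & G k x.
Proof.
move=> GL cov; apply: contrapT => nfin.
pose bad n z := ~ exists N, forall x, agree_upto x z n ->
  exists2 k, (k < N)%N & G k x.
have [z0] : exists z : seqs, True.
  apply: contrapT => nz; apply: nfin; exists 0%N => x; exfalso.
  by apply: nz; exists x.
move=> _; have bad0 : bad 0%N z0.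
  by move=> [N HN]; apply: nfin; exists N => x; apply: HN => -[].
have /choice[c cP] : forall q : nat * seqs, exists j,
    bad q.1 q.2 -> bad q.1.+1 (upd q.2 q.1.+1 j).
  move=> [n z] /=; apply: contrapT => noj.
  have bnz : bad n z by apply: contrapT => nb; apply: noj; exists (entry z 1).
  have {}noj j : exists N, forall x, agree_upto x (upd z n.+1 j) n.+1 ->
      exists2 k, (k < N)%N & G k x.
    by apply: contrapT => Hj; apply: noj; exists j => _.
  have [N NP] := choice noj.
  apply: bnz; exists (\max_j N j) => x xz.
  have [|k kN Gk] := NP (entry x n.+1) x.
    apply/agree_uptoS; split; last by rewrite entry_upd.
    by apply: agree_upto_trans xz _; exact/agree_uptoC/upd_agree.
  by exists k => //; apply: leq_trans kN _; exact: leq_bigmax.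
pose Z := fix Z n := if n is n'.+1 then upd (Z n') n (c (n', Z n')) else z0.
have badZ n : bad n (Z n) by elim: n => //= n IH; exact: (cP (n, Z n)).
have agZ n k : agree_upto (Z (n + k)%N) (Z n) n.
  elim: k => [|k IH]; first by rewrite addn0.
  rewrite addnS; apply: agree_upto_trans IH => /=.
  by apply: upd_agree; rewrite ltnS leq_addr.
pose x : seqs := fun i => entry (Z i.+1) i.+1.
have xZ n : agree_upto x (Z n) n.
  move=> i /andP[i1 iN]; rewrite {1}/entry /x prednK//.
  by rewrite -(subnKC iN) agZ// i1 leqnn.
have [k Gk] := cov x.
apply: (badZ (L k)); exists k.+1 => y yZ; exists k => //.
apply: GL Gk; apply: agree_upto_trans (xZ (L k)) _; exact: agree_uptoC.
Qed.

Lemma sum_inv_sqr_le2 N :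
  \sum_(k < N) (k.+1%:R ^- 2 : R) <= 2.
Proof.
case: N => [|N]; first by rewrite big_ord0.
suff : \sum_(k < N.+1) (k.+1%:R ^- 2 : R) <= 2 - N.+1%:R^-1.
  by move=> h; apply: le_trans h _; rewrite gerDl oppr_le0 invr_ge0.
elim: N => [|N IH]; first by rewrite big_ord1 expr1n invr1; lra.
rewrite big_ord_recr /=; apply: le_trans (lerD IH (lexx _)) _.
rewrite -addrA lerD2l -lerBrDl opprK -(natr1 N.+1).
have : 0 < N.+1%:R :> R by rewrite ltr0n.
move: N.+1%:R => t t0.
have -> : - (t + 1)^-1 + t^-1 = (t * (t + 1))^-1 by field; lra.
by rewrite lef_pV2 ?posrE ?exprn_gt0 ?mulr_gt0 ?expr2 ?ler_wpM2r//; lra.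
Qed.

Variables (pi : 'I_m -> R) (p : 'I_m -> 'I_m -> R).
Hypothesis st : stochastic pi p.
Variables (I : finType) (a : I -> 'I_m -> R) (b : I -> 'I_m -> 'I_m -> R).
Variable C : R.
Hypothesis C0 : 0 < C.
Hypothesis aC : forall i j, `|a i j| <= C.
Hypothesis bC : forall i j k, `|b i j k| <= C.

(** With the exponent [1 / (2 C sqrt n)] in the exponential moment, the
    probability that one martingale exceeds this threshold at time [n] is at
    most a fraction [1 / (4 (#|I| + 1))] of [1 / n^2]. *)
Definition threshold (n : nat) : R :=
  2 * C * Num.sqrt n%:R * (2 * ln n%:R + (2 + ln (8 * #|I|.+1%:R))).

Definition typical : set seqs :=
  [set x | forall i n, (0 < n)%N ->
    `|martingale pi p (a i) (b i) n x| <= threshold n].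

Lemma threshold_negligible e : 0 < e ->
  exists N, forall n, (N <= n)%N -> threshold n <= e * n%:R.
Proof.
move=> e0; pose c : R := 2 + ln (8 * #|I|.+1%:R).
pose A := 2 * C * (8 + `|c|) / e.
have A0 : 0 < A.
  by rewrite divr_gt0// !mulr_gt0// ltr_wpDr.
exists (Num.bound (A ^+ 4)).+1 => n nN.
have nA : A ^+ 4 <= n%:R.
  apply: le_trans (ltW (archi_boundP _)) _; first by rewrite exprn_ge0 ?ltW.
  by rewrite ler_nat ltnW.
have n1 : 1 <= n%:R :> R by rewrite ler1n; case: n nN {nA}.
(* [u] is the fourth root of [n], so that [ln n <= 4 u]. *)
pose r : R := Num.sqrt n%:R; pose u := Num.sqrt r.
have r1 : 1 <= r by rewrite -sqrtr1 ler_sqrt//; lra.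
have u1 : 1 <= u by rewrite -sqrtr1 ler_sqrt//; lra.
have rE : r ^+ 2 = n%:R by rewrite sqr_sqrtr//; lra.
have uE : u ^+ 2 = r by rewrite sqr_sqrtr//; lra.
have uA : A <= u.
  rewrite -(@ler_pXn2r _ 4)// ?nnegrE ?(ltW A0)//; last by lra.
  by rewrite (exprM u 2 2) uE rE.
have lnn : ln n%:R <= 4 * u.
  have u0 : 0 < u by lra.
  rewrite -rE -uE -exprM lnXn// -[ln u *+ _]mulr_natl.
  by rewrite ler_pM2l// ltW// ln_sublinear.
have Au : 2 * C * (8 + `|c|) <= e * u.
  by rewrite -ler_pdivrMl// mulrC.
rewrite /threshold -/c -/r -rE -uE.
have -> : 2 * C * u ^+ 2 * (2 * ln ((u ^+ 2) ^+ 2) + c) =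
  u ^+ 2 * (2 * C * (2 * ln (n%:R) + c)) by rewrite uE rE; ring.
have -> : e * (u ^+ 2) ^+ 2 = u ^+ 2 * (e * u ^+ 2) by ring.
rewrite ler_wpM2l ?sqr_ge0//.
apply: (@le_trans _ _ (2 * C * ((8 + `|c|) * u))).
  rewrite ler_pM2l ?mulr_gt0//.
  have : 0 <= `|c| * (u - 1) by rewrite mulr_ge0//; lra.
  have := ler_norm c; lra.
by rewrite mulrA expr2 mulrA ler_wpM2r//; lra.
Qed.

(** Cylinders that cover the typical set cover everything together with the
    exceptional sets.  Finitely many of these finitely determined sets suffice;
    integrating the resulting pointwise inequality leaves mass at least [1/2]
    to the cylinders, as the exceptional sets have total mass at most [1/2]. *)
Lemma typical_cover_mass (P : pred nat) (c : nat -> seqs) (l : nat -> nat) :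
  (forall x, typical x -> exists2 k, P k & agree_upto x (c k) (l k)) ->
  exists N, 1 / 2 <= \sum_(k < N | P k) mass pi p (l k) (c k).
Proof.
move=> cov.
pose M i n x := martingale pi p (a i) (b i) n x.
have [N NP] : exists N, forall x, exists2 k, (k < N)%N &
    (P k /\ agree_upto x (c k) (l k)) \/ exists i, threshold k.+1 < `|M i k.+1 x|.
  apply: (@finite_subcover (fun k x => (P k /\ agree_upto x (c k) (l k)) \/
      exists i, threshold k.+1 < `|M i k.+1 x|) (fun k => maxn (l k) k.+1)).
    move=> k x y xy [[Pk xc]|[i Mi]].
      left; split=> //; apply: agree_upto_trans xc; apply/agree_uptoC.
      by apply: agree_upto_le xy; rewrite leq_maxl.
    right; exists i; rewrite /M -(@martingale_adapted _ _ _ _ _ _ _ x)//.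
    by apply: agree_upto_le xy; rewrite leq_maxr.
  move=> x; have [/cov[k Pk xk]|nt] := pselect (typical x).
    by exists k; left.
  apply: contrapT => none; apply: nt => i [//|n] _; rewrite leNgt.
  by apply/negP => Mi; apply: none; exists n; right; exists i.
exists N.
pose lam k : R := (2 * C * Num.sqrt k.+1%:R)^-1.
pose F k i x := expR (- (lam k * threshold k.+1)) *
  (expR (lam k * M i k.+1 x) + expR (- lam k * M i k.+1 x)).
pose G k x := (if P k then (`[< agree_upto x (c k) (l k) >])%:R else 0)
    + \sum_i F k i x.
have F0 k i x : 0 <= F k i x by rewrite mulr_ge0 ?addr_ge0 ?expR_ge0.
have G1 x : 1 <= \sum_(k < N) G k x.
  have [k kN Gk] := NP x.
  rewrite (bigD1 (Ordinal kN))//= -[leLHS]addr0 lerD//; last first.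
    by apply: sumr_ge0 => i _; rewrite addr_ge0 ?sumr_ge0//; case: ifP.
  case: Gk => [[Pk xk]|[i Mi]].
    by rewrite /G Pk asboolT// lerDl sumr_ge0.
  rewrite /G -[leLHS]add0r lerD//; first by case: ifP.
  rewrite (bigD1 i)//= -[leLHS]addr0.
  rewrite lerD ?sumr_ge0//.
  have E1 t : threshold k.+1 < t ->
      1 <= expR (- (lam k * threshold k.+1)) * expR (lam k * t).
    move=> tt; rewrite -expRD -expR0 ler_expR addrC -mulrBr mulr_ge0//.
      by rewrite invr_ge0 !mulr_ge0 ?sqrtr_ge0 ?ltW.
    by rewrite subr_ge0 ltW.
  rewrite /F mulrDr; have [M0|M0] := leP 0 (M i k.+1 x).
    by rewrite -[leLHS]addr0 lerD ?mulr_ge0 ?expR_ge0// E1// -(ger0_norm M0).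
  rewrite -[leLHS]add0r lerD ?mulr_ge0 ?expR_ge0// mulNr -mulrN.
  by rewrite E1// -(ltr0_norm M0).
have c0 : 0 < 8 * #|I|.+1%:R :> R by rewrite mulr_gt0.
have EF k i n x : (k < n)%N ->
    expect pi p n (F k i) x <= 2 * (8 * #|I|.+1%:R)^-1 * k.+1%:R ^- 2.
  move=> kn.
  have s0 : 0 < Num.sqrt k.+1%:R :> R by rewrite sqrtr_gt0 ltr0n.
  have s2 : Num.sqrt k.+1%:R ^+ 2 = k.+1%:R :> R by rewrite sqr_sqrtr ?ler0n.
  have lam0 : 0 < lam k by rewrite invr_gt0 !mulr_gt0.
  have lamC : lam k * (2 * C) <= 1.
    rewrite ler_pdivrMl ?mulr_gt0// mulr1 ler_pMr ?mulr_gt0//.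
    by rewrite -[leLHS]sqrtr1 ler_sqrt ?ler1n ?ler0n.
  have E v : v ^+ 2 = lam k ^+ 2 ->
      expect pi p n (fun y => expR (v * M i k.+1 y)) x <= expR 2.
    move=> v2; have nv : `|v| = lam k.
      by rewrite -sqrtr_sqr v2 sqrtr_sqr gtr0_norm.
    rewrite (@expect_adapted _ _ _ _ st k.+1)//; last first.
      by move=> y z yz; rewrite /M (@martingale_adapted _ _ _ _ _ _ _ y z).
    apply: le_trans (expect_exp_martingale st (aC i) (bC i) k.+1 x _) _.
      by rewrite nv.
    rewrite ler_expR v2 -[k.+1%:R]s2 /lam le_eqVlt; apply/orP; left; apply/eqP.
    by field; rewrite !gt_eqF.
  rewrite /F expectZ expectD.
  have -> : expR (- (lam k * threshold k.+1)) =
      expR (- 2) * (8 * #|I|.+1%:R)^-1 * k.+1%:R ^- 2.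
    have -> : lam k * threshold k.+1 = 2 * ln k.+1%:R + (2 + ln (8 * #|I|.+1%:R)).
      by rewrite /lam /threshold; field; rewrite !gt_eqF.
    rewrite !opprD !expRD (expRN (ln _)) lnK ?posrE// expRN expRM_natl lnK ?posrE//.
    by rewrite mulrC.
  set w := expR (- 2) * _ * _; have w0 : 0 <= w.
    by rewrite !mulr_ge0 ?expR_ge0 ?invr_ge0 ?(ltW c0).
  apply: le_trans (ler_wpM2l w0 (lerD (E _ erefl) (E _ (sqrrN _)))) _.
  rewrite /w expRN le_eqVlt; apply/orP; left; apply/eqP.
  by field; rewrite ?pnatr_eq0 ?gt_eqF ?expR_gt0.
pose n := (\max_(k < N) maxn (l k) k.+1)%N.
have nP (k : 'I_N) : (l k <= n)%N /\ (k < n)%N.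
  have := @leq_bigmax _ (fun k : 'I_N => maxn (l k) k.+1) k.
  by rewrite geq_max => /andP[].
have := expect_le st n (c 0%N) G1; rewrite (expect_cst st) expect_sum.
rewrite (eq_bigr (fun k : 'I_N => (if P k then mass pi p (l k) (c k) else 0) +
    \sum_i expect pi p n (F k i) (c 0%N))); last first.
  move=> k _; rewrite /G expectD expect_sum; congr (_ + _).
  case: ifP => _; last exact: expect_cst.
  rewrite (@expect_adapted _ _ _ _ st (l k)) ?expect_cylinder//.
    by have [] := nP k.
  move=> y z yz; congr (nat_of_bool _)%:R; apply/asbool_equiv_eq; split.
    exact/agree_upto_trans/agree_uptoC.
  exact: agree_upto_trans.
rewrite big_split /= -big_mkcond /= => h.
suff : \sum_(k < N) \sum_i expect pi p n (F k i) (c 0%N) <= 1 / 2 by lra.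
apply: (@le_trans _ _ (\sum_(k < N) 1 / 4 * k.+1%:R ^- 2)).
  apply: ler_sum => k _.
  apply: (@le_trans _ _ (\sum_(i : I) 2 * (8 * #|I|.+1%:R)^-1 * k.+1%:R ^- 2)).
    by apply: ler_sum => i _; apply: EF; have [] := nP k.
  rewrite sumr_const -mulrnAl -mulr_natr ler_wpM2r ?invr_ge0 ?exprn_ge0//.
  rewrite mulrAC ler_pdivrMr//.
  have : #|I|%:R <= #|I|.+1%:R :> R by rewrite ler_nat.
  by lra.
rewrite -mulr_sumr; have := sum_inv_sqr_le2 N; lra.
Qed.

End TypicalSet.

(** * Laws of large numbers, uniform on a set *)

Section UniformNegligible.
Context {R : realType} {m : nat}.
Local Notation seqs := (symbolic_space R m).
Implicit Types (G H E : nat -> seqs -> R).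
Variable K : set seqs.

(** The estimate is uniform on [K] because the mass distribution principle
    asks for one length beyond which all cylinders around [K] are small. *)
Definition negligible G : Prop := forall e, 0 < e ->
  exists N, forall n x, (N <= n)%N -> K x -> `|G n x| <= e * n%:R.

Lemma negligible_le G H : (forall n x, K x -> `|G n x| <= `|H n x|) ->
  negligible H -> negligible G.
Proof.
move=> GH nH e e0; have [N HN] := nH e e0; exists N => n x nN Kx.
exact: le_trans (GH n x Kx) (HN n x nN Kx).
Qed.

Lemma negligibleD G H : negligible G -> negligible H ->
  negligible (fun n x => G n x + H n x).
Proof.
move=> nG nH e e0; have e2 : 0 < e / 2 by rewrite divr_gt0.
have [N1 H1] := nG _ e2; have [N2 H2] := nH _ e2.
exists (maxn N1 N2) => n x; rewrite geq_max => /andP[n1 n2] Kx.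
apply: le_trans (ler_normD _ _) _; rewrite [e]splitr mulrDl.
by rewrite lerD ?H1 ?H2.
Qed.

Lemma negligible_bounded G c : (forall n x, K x -> `|G n x| <= c) -> negligible G.
Proof.
move=> Gc e e0; exists (Num.bound (`|c| / e)) => n x nN Kx.
apply: le_trans (Gc n x Kx) (le_trans (ler_norm c) _).
rewrite -ler_pdivrMl// mulrC (le_trans (ltW (archi_boundP _)))//.
  by rewrite divr_ge0 // ltW.
by rewrite ler_nat.
Qed.

Lemma negligibleZ c G : negligible G -> negligible (fun n x => c * G n x).
Proof.
move=> nG e e0; have c0 : 0 < `|c| + 1 by rewrite ltr_wpDl.
have [N HN] := nG (e / (`|c| + 1)) (divr_gt0 e0 c0).
exists N => n x nN Kx; rewrite normrM.
apply: le_trans (ler_wpM2l (normr_ge0 c) (HN n x nN Kx)) _.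
rewrite mulrA ler_wpM2r// mulrCA -[leRHS]mulr1 ler_pM2l//.
by rewrite ler_pdivrMr// mul1r lerDl.
Qed.

Lemma negligible_sum (I : Type) (r : seq I) (G : I -> nat -> seqs -> R) :
  (forall i, negligible (G i)) -> negligible (fun n x => \sum_(i <- r) G i n x).
Proof.
move=> nG; elim: r => [|i r IH].
  by apply: (@negligible_bounded _ 0) => n x _; rewrite big_nil normr0.
apply: negligible_le (negligibleD (nG i) IH) => n x _.
by rewrite big_cons.
Qed.

Lemma negligible_abs G : negligible G -> negligible (fun n x => `|G n x|).
Proof. by apply: negligible_le => n x _; rewrite normr_id. Qed.

Lemma negligible_half G : negligible G -> negligible (fun n x => G n./2 x).
Proof.
move=> nG e e0; have [N HN] := nG e e0; exists N.*2 => n x nN Kx.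
apply: le_trans (HN _ x _ Kx) _; first by lia.
by rewrite ler_pM2l// ler_nat; lia.
Qed.

(** Iterating [E n <= E (n / 2) + o(n)] adds errors [o(n)], [o(n / 2)], ...,
    whose sum is [o(n)]. *)
Lemma negligible_halving E H c :
  (forall n x, K x -> 0 <= E n x <= c * n%:R) ->
  (forall n x, K x -> E n x <= E n./2 x + H n x) ->
  negligible H -> negligible E.
Proof.
move=> Ec EH nH e e0; have e3 : 0 < e / 3 by rewrite divr_gt0.
have [N HN] := nH _ e3; pose c' := `|c| * N%:R.
have main n x : K x -> E n x <= 2 * (e / 3) * n%:R + c'.
  move=> Kx; elim/ltn_ind : n => n IH.
  have /andP[_ En] := Ec n x Kx.
  have [nN|Nn] := ltnP n N.
    apply: le_trans En _; rewrite -[leLHS]add0r lerD//.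
      by rewrite !mulr_ge0// ltW.
    apply: le_trans (ler_wpM2r (ler0n _ _) (ler_norm c)) _.
    by rewrite ler_wpM2l// ler_nat ltnW.
  have [n0|n0] := posnP n.
    by apply: le_trans En _; rewrite n0 !mulr0 add0r mulr_ge0.
  apply: le_trans (EH n x Kx) _.
  have -> : 2 * (e / 3) * n%:R + c' = (e / 3 * n%:R + c') + e / 3 * n%:R by ring.
  rewrite lerD//; last exact: le_trans (ler_norm _) (HN n x Nn Kx).
  have hn : (n./2 < n)%N by lia.
  apply: le_trans (IH _ hn) _; rewrite lerD2r.
  have -> : 2 * (e / 3) * n./2%:R = e / 3 * (2 * n./2)%:R by rewrite natrM; ring.
  by rewrite ler_pM2l// ler_nat; lia.
exists (Num.bound (c' / (e / 3))) => n x nN Kx.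
have /andP[E0 _] := Ec n x Kx; rewrite ger0_norm//.
apply: le_trans (main n x Kx) _.
have -> : e * n%:R = 2 * (e / 3) * n%:R + e / 3 * n%:R by field.
rewrite lerD2l -ler_pdivrMl// mulrC (le_trans (ltW (archi_boundP _)))//.
  by rewrite divr_ge0// ?mulr_ge0// ltW.
by rewrite ler_nat.
Qed.

End UniformNegligible.

Section Frequencies.
Context {R : realType} {m : nat}.
Local Notation seqs := (symbolic_space R m).
Variables (pi : 'I_m -> R) (p : 'I_m -> 'I_m -> R).
Hypothesis st : stochastic pi p.

Lemma compensatorE (a : 'I_m -> R) (b : 'I_m -> 'I_m -> R) n (x : seqs) :
  compensator pi p a b n x = (uphalf n)%:R * \sum_j pi j * a j
    + \sum_(1 <= k < n./2.+1) \sum_j p (entry x k) j * b (entry x k) j.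
Proof.
elim: n => [|n IH].
  by rewrite /compensator !big_geq// mul0r addr0.
rewrite compensatorS IH.
have -> : drift pi p a b n.+1 x = if odd n then
    \sum_j p (entry x (uphalf n)) j * b (entry x (uphalf n)) j
    else \sum_j pi j * a j.
  by rewrite /drift /step /gain /=; case: (odd n).
rewrite /= uphalf_half; case: (odd n); last first.
  by rewrite /= !add0n -[n./2.+1%:R]natr1; ring.
by rewrite add1n [in RHS]big_nat_recr//= -addrA.
Qed.

Definition visits (j : 'I_m) (n : nat) (x : seqs) : R :=
  score (fun i => (i == j)%:R) (fun _ i => (i == j)%:R) n x.

Lemma visitsE j n x : visits j n x = \sum_(1 <= k < n.+1) (entry x k == j)%:R.
Proof. by apply: eq_bigr => k _; rewrite /gain if_same. Qed.

Lemma sum_visits (B : 'I_m -> R) n (x : seqs) :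
  \sum_(1 <= k < n.+1) B (entry x k) = \sum_i visits i n x * B i.
Proof.
under [RHS]eq_bigr do rewrite visitsE mulr_suml.
rewrite exchange_big; apply: eq_bigr => k _.
rewrite (bigD1 (entry x k))//= eqxx mul1r big1 ?addr0// => i ik.
by rewrite eq_sym (negbTE ik) mul0r.
Qed.

Lemma visits_bound j n x : 0 <= visits j n x <= n%:R.
Proof.
rewrite visitsE sumr_ge0//=.
apply: (@le_trans _ _ (\sum_(1 <= k < n.+1) 1)).
  by apply: ler_sum => k _; rewrite lern1 leq_b1.
by rewrite sumr_const_nat subn1.
Qed.

(** The stationary frequencies of the symbols: half of the indices start a
    chain, the other half continue the chain of their half. *)
Variable q : 'I_m -> R.
Hypothesis qE : forall j, 2 * q j = pi j + \sum_i q i * p i j.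

Variable K : set seqs.
Hypothesis visits_mart : forall j, negligible K
  (martingale pi p (fun i => (i == j)%:R) (fun _ i => (i == j)%:R)).

(** The deviations of the visits from [n q] at time [n] are, up to martingale
    errors, those at time [n / 2] transported by the stochastic matrix [p],
    which does not increase their sum of absolute values. *)
Lemma visits_frequency j : negligible K (fun n x => visits j n x - n%:R * q j).
Proof.
pose E n x : R := \sum_i `|visits i n x - n%:R * q i|.
pose c : R := \sum_i `|\sum_l q l * p l i - pi i|.
suff nE : negligible K E.
  apply: negligible_le nE => n x _.
  by rewrite [leRHS]ger0_norm ?sumr_ge0// /E (bigD1 j)//= lerDl sumr_ge0.
pose M i := martingale pi p (fun l => (l == i)%:R) (fun _ l => (l == i)%:R).
apply: (@negligible_halving _ _ _ _ (fun n x => \sum_i `|M i n x| + c)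
  (\sum_i (1 + `|q i|))); last first.
- apply: negligibleD; last exact: (@negligible_bounded _ _ _ _ `|c|).
  by apply: negligible_sum => i; exact/negligible_abs/visits_mart.
- move=> n x Kx.
  have vE i : visits i n x - n%:R * q i = (M i n x +
      (odd n)%:R / 2 * (pi i - \sum_l q l * p l i)) +
      \sum_l (visits l n./2 x - n./2%:R * q l) * p l i.
    have -> : visits i n x = M i n x + (uphalf n)%:R * pi i
        + \sum_l visits l n./2 x * p l i.
      have one (f : 'I_m -> R) : \sum_j f j * (j == i)%:R = f i.
        rewrite (bigD1 i)//= eqxx mulr1 big1 ?addr0// => l li.
        by rewrite (negbTE li) mulr0.
      rewrite /M /martingale -/(visits i n x) compensatorE one.
      rewrite (eq_bigr (fun k => p (entry x k) i)) => [|k _]; last exact: one.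
      by rewrite (sum_visits (p^~ i)); ring.
    have -> : \sum_l (visits l n./2 x - n./2%:R * q l) * p l i =
        \sum_l visits l n./2 x * p l i - n./2%:R * \sum_l q l * p l i.
      by rewrite mulr_sumr -sumrB; apply: eq_bigr => l _; ring.
    have := qE i; set S := \sum_l q l * p l i => qi.
    have nE : n%:R = (odd n)%:R + 2 * n./2%:R :> R.
      by rewrite -{1}(odd_double_half n) natrD -muln2 natrM mulrC.
    have -> : q i = (pi i + S) / 2 by rewrite -qi mulrC mulKf.
    by rewrite uphalf_half natrD nE; field.
  apply: (@le_trans _ _ (\sum_i (`|M i n x| + `|\sum_l q l * p l i - pi i|
      + \sum_l `|visits l n./2 x - n./2%:R * q l| * p l i))).
    apply: ler_sum => i _; rewrite vE; apply: le_trans (ler_normD _ _) _.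
    rewrite lerD//.
      apply: le_trans (ler_normD _ _) _; rewrite lerD2l normrM distrC.
      by rewrite ler_piMl// ger0_norm//; case: (odd n) => /=; lra.
    apply: le_trans (ler_norm_sum _ _ _) _; apply: ler_sum => l _.
    by rewrite normrM (ger0_norm (_ : 0 <= p l i))//; case: st.
  rewrite 2!big_split /= addrC lerD2r /E exchange_big /=.
  apply: ler_sum => l _; rewrite -mulr_sumr; case: st => _ _ _ ->.
  by rewrite mulr1.
- move=> n x _; rewrite /E sumr_ge0//= mulr_suml; apply: ler_sum => i _.
  apply: le_trans (ler_normB _ _) _.
  have /andP[v0 v1] := visits_bound i n x.
  by rewrite ger0_norm// normrM ger0_norm// mulrDl mul1r lerD// mulrC.
Qed.

(** A score is a martingale plus its compensator, and the latter only depends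
    on the frequencies of the symbols. *)
Lemma score_average (a : 'I_m -> R) (b : 'I_m -> 'I_m -> R) :
  negligible K (martingale pi p a b) ->
  negligible K (fun n x => score a b n x -
    n%:R * ((\sum_j pi j * a j + \sum_i q i * \sum_j p i j * b i j) / 2)).
Proof.
move=> nM; pose A := \sum_j pi j * a j; pose B i := \sum_j p i j * b i j.
have nv : negligible K (fun n x => \sum_i B i *
    (visits i n./2 x - n./2%:R * q i)).
  apply: negligible_sum => i; apply: negligibleZ.
  exact: (negligible_half (visits_frequency i)).
have nb : negligible K (fun n x => (odd n)%:R * ((A - \sum_i q i * B i) / 2)).
  apply: (@negligible_bounded _ _ _ _ `|(A - \sum_i q i * B i) / 2|) => n x _.
  by rewrite normrM ler_piMl// ger0_norm// lern1 leq_b1.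
apply: negligible_le (negligibleD (negligibleD nM nv) nb) => n x _.
rewrite le_eqVlt; apply/orP; left; apply/eqP; congr `|_|.
rewrite /martingale compensatorE (sum_visits B) -/A.
have -> : \sum_i B i * (visits i n./2 x - n./2%:R * q i) =
    \sum_i visits i n./2 x * B i - n./2%:R * \sum_i q i * B i.
  by rewrite mulr_sumr -sumrB; apply: eq_bigr => i _; ring.
have nE : n%:R = (odd n)%:R + 2 * n./2%:R :> R.
  by rewrite -{1}(odd_double_half n) natrD -muln2 natrM mulrC.
by rewrite uphalf_half natrD nE -/B; field.
Qed.

End Frequencies.

(** * The mass distribution principle *)

Section MassDistribution.
Context {R : realType} {m : nat}.
Hypothesis m2 : (2 <= m)%N.
Local Notation seqs := (symbolic_space R m).
Implicit Types (x y z : seqs).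

Lemma ln_alphabet_gt0 : 0 < ln m%:R :> R.
Proof. by rewrite ln_gt0// ltr1n. Qed.

(** The [s]-th power of the diameter of a cylinder of length [n]. *)
Definition scale (n : nat) (s : R) : R := expR (- (n%:R * (s * ln m%:R))).

Lemma inv_expE n : (m%:R : R) ^- n = expR (- (n%:R * ln m%:R)).
Proof. by rewrite expRN expRM_natl lnK// posrE ltr0n; case: m m2. Qed.

Lemma scale_le n s s' : s <= s' -> scale n s' <= scale n s.
Proof.
move=> ss'; rewrite /scale ler_expR lerN2 ler_wpM2l// ler_wpM2r//.
exact/ltW/ln_alphabet_gt0.
Qed.

Lemma powR_inv_exp n s : ((m%:R : R) ^- n) `^ s = scale n s.
Proof.
rewrite inv_expE /powR gt_eqF ?expR_gt0// expRK /scale; congr expR; ring.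
Qed.

Lemma scale_small s e : 0 < s -> 0 < e ->
  exists N, forall n, (N <= n)%N -> scale n s <= e.
Proof.
move=> s0 e0; have sl : 0 < s * ln m%:R by rewrite mulr_gt0// ln_alphabet_gt0.
exists (Num.bound (`|ln e| / (s * ln m%:R))) => n nN.
rewrite /scale -[leRHS]lnK// ler_expR lerNl (le_trans (ler_norm _))//.
rewrite normrN -ler_pdivrMr// (le_trans (ltW (archi_boundP _)))//.
  by rewrite divr_ge0// ltW.
by rewrite ler_nat.
Qed.

Lemma dist_agree x y n : agree_upto x y n -> symbolic_dist x y <= (m%:R : R) ^- n.
Proof.
move=> xy; rewrite /symbolic_dist; case: ifPn => [_|nxy].
  by rewrite invr_ge0 exprn_ge0.
have [_ h] := common_prefixP nxy.
have /andP[m0 m1] := @symbolic_gt0 R _ x.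
by rewrite lef_pV2 ?posrE ?exprn_gt0// ler_weXn2l// h.
Qed.

Lemma diam_ge x y (U : set seqs) : U x -> U y ->
  ((symbolic_dist x y)%:E <= diam U)%E.
Proof. by move=> Ux Uy; apply: ereal_sup_ubound; exists (x, y). Qed.

Lemma diam_pow_ge0 s (U : set seqs) : (0 <= diam_pow s U)%E.
Proof. by rewrite /diam_pow; case: ifP => // _; exact: poweR_ge0. Qed.

(** A set lies in a cylinder of the same diameter, except that a single point
    lies in cylinders of any length. *)
Lemma enclosing_cylinder (U : set seqs) x s s' e N :
  U x -> 0 <= s -> s <= s' -> 0 < s' -> 0 < e ->
  (diam U <= ((m%:R : R) ^- N)%:E)%E ->
  exists n, [/\ (N <= n)%N, forall y, U y -> agree_upto y x n &
    ((scale n s')%:E <= diam_pow s U + e%:E)%E].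
Proof.
move=> Ux s0 ss' s'0 e0 dU.
have [[y0 [Uy0 y0x]]|none] := pselect (exists y, U y /\ y != x); last first.
  have [N' HN'] := scale_small s'0 e0.
  exists (maxn N N'); split; first exact: leq_maxl.
    move=> y Uy; have -> // : y = x.
    by apply/eqP/negPn/negP => yx; apply: none; exists y.
  rewrite -[leLHS]add0e leeD ?diam_pow_ge0// lee_fin HN'//.
  exact: leq_maxr.
have ex : exists n, `[< exists y, [/\ U y, y != x & common_prefix y x = n] >].
  by exists (common_prefix y0 x); apply/asboolP; exists y0.
case: (ex_minnP ex) => n /asboolP[y [Uy yx cn]] nmin.
have dxy : symbolic_dist y x = (m%:R : R) ^- n.
  by rewrite /symbolic_dist (negbTE yx) cn.
have dn : (((m%:R : R) ^- n)%:E <= diam U)%E by rewrite -dxy; exact: diam_ge.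
exists n; split.
- have := le_trans dn dU; rewrite lee_fin lef_pV2 ?posrE ?exprn_gt0 ?ltr0n ?(ltnW m2)//.
  by rewrite ler_eXn2l// ltr1n.
- move=> z Uz; have [->//|zx] := eqVneq z x.
  have [h _] := common_prefixP zx; apply: agree_upto_le h.
  by apply: nmin; apply/asboolP; exists z.
rewrite -[leLHS]adde0 leeD//; last by rewrite lee_fin ltW.
rewrite /diam_pow ifN; last by apply/set0P; exists x.
apply: (@le_trans _ _ (((m%:R : R) ^- n)%:E `^ s)%E).
  by rewrite poweR_EFin powR_inv_exp lee_fin scale_le.
by apply: gt0_ler_poweR => //; rewrite in_itv/= leey andbT ?lee_fin ?(le_trans _ dn) ?lee_fin// invr_ge0 exprn_ge0.
Qed.

(** Sets of a cover that meet [K] are enlarged to cylinders at the cost of an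
    arbitrarily small summable error; the powers of their diameters dominate
    the masses of these cylinders, which add up to at least [1/2]. *)
Lemma mass_distribution (K A : set seqs) (W : nat -> seqs -> R) (beta : R) :
  K `<=` A ->
  (forall s, s < beta -> exists N, forall n x, (N <= n)%N -> K x ->
    W n x <= scale n s) ->
  (forall (P : pred nat) (c : nat -> seqs) (l : nat -> nat),
    (forall x, K x -> exists2 k, P k & agree_upto x (c k) (l k)) ->
    exists N, 1 / 2 <= \sum_(k < N | P k) W (l k) (c k)) ->
  (beta%:E <= hausdorff_dim A)%E.
Proof.
move=> KA Wsmall Wcov; apply: le_ereal_inf_tmp => _ [s [s0 Hs] <-].
rewrite lee_fin leNgt; apply/negP => sb.
pose s' := (s + beta) / 2.
have ss' : s <= s' by rewrite /s'; lra.
have s'0 : 0 < s' by rewrite /s'; lra.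
have s'b : s' < beta by rewrite /s'; lra.
have [N HN] := Wsmall _ s'b.
pose delta : R := m%:R ^- N.
have d0 : 0 < delta by rewrite invr_gt0 exprn_gt0// ltr0n (ltnW m2).
have : (hausdorff_premeasure s delta A < (1 / 4)%:E)%E.
  apply: le_lt_trans (_ : (0 < _)%E); last by rewrite lte_fin; lra.
  by rewrite -Hs; apply: ereal_sup_ubound; exists delta.
move=> /ereal_inf_lt[_ [U [AU dU] <-]] small.
pose e k : R := 1 / 8 * k.+1%:R ^- 2.
have e0 k : 0 < e k by rewrite mulr_gt0// invr_gt0 exprn_gt0.
have /choice[cl clP] : forall k, exists cl : seqs * nat,
    (exists2 x, K x & U k x) -> [/\ K cl.1, (N <= cl.2)%N,
      forall y, U k y -> agree_upto y cl.1 cl.2 &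
      ((scale cl.2 s')%:E <= diam_pow s (U k) + (e k)%:E)%E].
  move=> k; have [[x Kx Ux]|no] := pselect (exists2 x, K x & U k x).
    have [n [Nn Un dn]] := enclosing_cylinder Ux s0 ss' s'0 (e0 k) (dU k).
    by exists (x, n).
  have o : 'I_m by exists 0%N; exact: ltnW.
  by exists ((fun=> o) : seqs, 0%N) => /no.
pose P k := `[< exists2 x, K x & U k x >].
have [x Kx|M] := Wcov P (fun k => (cl k).1) (fun k => (cl k).2).
  have [k _ Uk] := AU x (KA x Kx).
  have Pk : exists2 x, K x & U k x by exists x.
  by exists k; [exact/asboolP|have [_ _ h _] := clP k Pk; exact: h].
apply/negP; rewrite -ltNge -lte_fin.
apply: (@le_lt_trans _ _ (\sum_(k < M) (diam_pow s (U k) + (e k)%:E))%E).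
  rewrite -sumEFin big_mkcond /=; apply: lee_sum => k _.
  case: ifPn => [/asboolP /clP[Kc Nc _ h]|_].
    by apply: le_trans h; rewrite lee_fin HN.
  by rewrite adde_ge0 ?diam_pow_ge0// lee_fin ltW.
rewrite big_split /= sumEFin.
have -> : (1 / 2)%:E = ((1 / 4)%:E + (1 / 4)%:E :> \bar R)%E.
  by rewrite -EFinD; congr EFin; field.
apply: lte_leD.
- by [].
- apply: le_lt_trans small.
  rewrite -(big_mkord xpredT (fun k => diam_pow s (U k))).
  by apply: nneseries_lim_ge => k _ _; exact: diam_pow_ge0.
- rewrite lee_fin -mulr_sumr; have := @sum_inv_sqr_le2 R M; lra.
Qed.

End MassDistribution.

Arguments scale {R} m n s.

(** * Lower bound for the dimension of level sets *)

Section LowerBound.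
Context {R : realType} {m : nat}.
Hypothesis m2 : (2 <= m)%N.
Local Notation seqs := (symbolic_space R m).

Lemma score_double (b : 'I_m -> 'I_m -> R) n (x : seqs) :
  score (fun=> 0) b n.*2 x = \sum_(1 <= k < n.+1) b (entry x k) (entry x (2 * k)).
Proof.
elim: n => [|n IH]; first by rewrite /score !big_geq.
rewrite doubleS !scoreS IH [in RHS]big_nat_recr//= /gain /= odd_double /= addr0.
by rewrite doubleK mul2n doubleS.
Qed.

Definition entropy (pi : 'I_m -> R) (p : 'I_m -> 'I_m -> R) (q : 'I_m -> R) : R :=
  - (\sum_j pi j * ln (pi j) + \sum_i q i * \sum_j p i j * ln (p i j)) / 2.

Variables (pi : 'I_m -> R) (p : 'I_m -> 'I_m -> R) (q : 'I_m -> R).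
Hypothesis st : stochastic pi p.
Hypothesis qE : forall j, 2 * q j = pi j + \sum_i q i * p i j.

(** Only an inequality when probabilities vanish: [ln 0 = 0] makes the right
    side positive, whereas the mass is [0]. *)
Lemma mass_le_exp_score n (x : seqs) :
  mass pi p n x <= expR (score (fun j => ln (pi j)) (fun i j => ln (p i j)) n x).
Proof.
have lnle (t : R) : 0 <= t -> t <= expR (ln t).
  by rewrite le_eqVlt => /predU1P[<-|t0]; [exact: expR_ge0|rewrite lnK].
elim: n => [|n IH]; first by rewrite mass0 /score big_geq// expR0.
rewrite massS scoreS expRD ler_pM ?mass_ge0 ?step_ge0//.
by case: st => a _ b _; rewrite /step /gain; case: ifP => _; exact: lnle.
Qed.

(** On the typical set the score of [(0, phi)] gives the level, and the score of
    [(ln pi, ln p)], whose average is minus the entropy, bounds the masses. *)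
Lemma level_set_dim_ge (phi : 'I_m -> 'I_m -> R) alpha :
  alpha = \sum_i q i * \sum_j p i j * phi i j ->
  ((entropy pi p q / ln m%:R)%:E <= hausdorff_dim (level_set phi alpha))%E.
Proof.
move=> alphaE.
pose I := option (option 'I_m).
pose a (i : I) : 'I_m -> R := match i with
  | None => fun=> 0 | Some None => fun j => ln (pi j)
  | Some (Some k) => fun j => (j == k)%:R end.
pose b (i : I) : 'I_m -> 'I_m -> R := match i with
  | None => phi | Some None => fun i j => ln (p i j)
  | Some (Some k) => fun _ j => (j == k)%:R end.
pose C : R := 1 + \sum_j `|ln (pi j)| + \sum_i \sum_j `|ln (p i j)| +
  \sum_i \sum_j `|phi i j|.
have S1 (f : 'I_m -> R) j : `|f j| <= \sum_j `|f j|.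
  by rewrite (bigD1 j)//= lerDl sumr_ge0.
have S2 (f : 'I_m -> 'I_m -> R) i j : `|f i j| <= \sum_i \sum_j `|f i j|.
  rewrite (bigD1 i)//=; apply: le_trans (S1 (f i) j) _.
  by rewrite lerDl sumr_ge0// => k _; rewrite sumr_ge0.
have P1 (f : 'I_m -> R) : 0 <= \sum_j `|f j| by rewrite sumr_ge0.
have P2 (f : 'I_m -> 'I_m -> R) : 0 <= \sum_i \sum_j `|f i j|.
  by rewrite sumr_ge0// => k _; rewrite sumr_ge0.
have A1 := P1 (fun j => ln (pi j)); have A2 := P2 (fun i j => ln (p i j)).
have A3 := P2 phi.
have C0 : 0 < C by rewrite /C; lra.
have aC i j : `|a i j| <= C.
  case: i => [[k|]|] /=.
  - by rewrite ger0_norm// (le_trans (_ : _ <= 1))// ?lern1 ?leq_b1// /C; lra.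
  - by apply: le_trans (S1 (fun j => ln (pi j)) j) _; rewrite /C; lra.
  - by rewrite normr0 ltW.
have bC i j k : `|b i j k| <= C.
  case: i => [[l|]|] /=.
  - by rewrite ger0_norm// (le_trans (_ : _ <= 1))// ?lern1 ?leq_b1// /C; lra.
  - by apply: le_trans (S2 (fun i j => ln (p i j)) j k) _; rewrite /C; lra.
  - by apply: le_trans (S2 phi j k) _; rewrite /C; lra.
pose K : set seqs := typical pi p a b C.
have nM i : negligible K (martingale pi p (a i) (b i)).
  move=> e e0; have [N HN] := threshold_negligible I C0 e0.
  exists N.+1 => n x nN Kx; apply: le_trans (Kx i n _) (HN n _).
    by case: n nN.
  exact: ltnW.
have avg i := score_average st qE (fun j => nM (Some (Some j))) (nM i).
apply: (mass_distribution m2 (K := K) (W := mass pi p)).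
- move=> x Kx; rewrite /level_set /=; apply/cvgrPdist_le => e e0.
  have [N HN] := avg None _ (divr_gt0 e0 (ltr0n R 2)).
  exists N.+1 => // n /= Nn.
  have n0 : 0 < n%:R :> R by rewrite ltr0n; case: n Nn.
  have /HN/(_ Kx) : (N <= n.*2)%N by lia.
  have z0 : \sum_j pi j * 0 = 0 by rewrite big1// => j _; rewrite mulr0.
  rewrite /= score_double z0 add0r -alphaE.
  rewrite -muln2 natrM (_ : n%:R * 2 * (alpha / 2) = n%:R * alpha); last by field.
  rewrite (_ : e / 2 * (n%:R * 2) = n%:R * e); last by field.
  set S := \sum_(_ <= _ < _) _ => h.
  rewrite distrC -(ler_pM2l n0) -{1}(ger0_norm (ltW n0)) -normrM.
  by rewrite mulrBr mulVKf ?gt_eqF.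
- move=> s sb; have l0 := @ln_alphabet_gt0 R m m2.
  have e0 : 0 < (entropy pi p q / ln m%:R - s) * ln m%:R.
    by rewrite mulr_gt0// subr_gt0.
  have [N HN] := avg (Some None) _ e0.
  exists N => n x Nn Kx; apply: le_trans (mass_le_exp_score n x) _.
  rewrite ler_expR; have := le_trans (ler_norm _) (HN n x Nn Kx).
  rewrite mulrBl divfK ?gt_eqF//= lerBlDr => /le_trans; apply.
  by rewrite le_eqVlt; apply/orP; left; apply/eqP; rewrite /entropy; field.
- by move=> P c l; exact: typical_cover_mass.
Qed.

End LowerBound.

(** * Upper bound for the dimension of level sets *)

Section CylinderCovers.
Context {R : realType} {m : nat}.
Hypothesis m2 : (2 <= m)%N.
Local Notation seqs := (symbolic_space R m).
Variables (pi : 'I_m -> R) (p : 'I_m -> 'I_m -> R).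
Hypothesis st : stochastic pi p.
Variable o : 'I_m.

Definition extend (w : seq 'I_m) : seqs := fun i => nth o w i.

Definition cylinder (w : seq 'I_m) : set seqs :=
  [set x | agree_upto x (extend w) (size w)].

Lemma cylinder_inj (w v : seq 'I_m) x :
  size w = size v -> cylinder w x -> cylinder v x -> w = v.
Proof.
move=> wv xw xv; apply: (@eq_from_nth _ o) => // i iw.
have := xw i.+1; have := xv i.+1; rewrite /entry /= -wv => h1 h2.
by rewrite -[nth o w i]/(extend w i) -[nth o v i]/(extend v i) -h1// -h2.
Qed.

Lemma diam_cylinder w :
  (diam (cylinder w) <= ((m%:R : R) ^- size w)%:E :> \bar R)%E.
Proof.
apply: ge_ereal_sup => _ [[x y] [/= xw yw] <-]; rewrite lee_fin.
by apply: dist_agree; apply: agree_upto_trans xw _; exact: agree_uptoC.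
Qed.

Lemma diam_pow_cylinder s w : 0 <= s ->
  (diam_pow s (cylinder w) <= (scale m (size w) s)%:E :> \bar R)%E.
Proof.
move=> s0; have cw : cylinder w (extend w) by [].
have d0 : (0 <= diam (cylinder w) :> \bar R)%E.
  by have := diam_ge cw cw; rewrite symbolic_distxx.
rewrite /diam_pow ifN; last by apply/set0P; exists (extend w).
rewrite -(powR_inv_exp m2) -poweR_EFin; apply: gt0_ler_poweR => //.
- by rewrite in_itv/= leey d0.
- by rewrite in_itv/= leey lee_fin invr_ge0 exprn_ge0.
exact: diam_cylinder.
Qed.

(** Integrate the fact that a point has one prefix of length [n], hence lies in
    the cylinder of at most one of the words of that length in the list. *)
Lemma sum_mass_le1 n M (w : nat -> option (seq 'I_m)) :
  (forall i j v, w i = Some v -> w j = Some v -> i = j) ->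
  \sum_(i < M) (if w i is Some v then
     (size v == n)%:R * mass pi p n (extend v) else 0) <= 1.
Proof.
move=> winj; rewrite -[leRHS](expect_cst st n 1 (extend [::])).
pose G i (x : seqs) : R := if w i is Some v then
  (size v == n)%:R * (`[< agree_upto x (extend v) n >])%:R else 0.
have -> : \sum_(i < M) (if w i is Some v then
     (size v == n)%:R * mass pi p n (extend v) else 0) =
    expect pi p n (fun x => \sum_(i < M) G i x) (extend [::]).
  rewrite expect_sum; apply: eq_bigr => i _; rewrite /G.
  case: (w i) => [v|]; last by rewrite expect_cst.
  by rewrite expectZ expect_cylinder.
apply: expect_le => // x.
have G01 i : 0 <= G i x <= 1.
  rewrite /G; case: (w i) => [v|]; last by rewrite lexx ler01.
  by rewrite -natrM ler0n lern1 mulnb leq_b1.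
have [[i Gi]|none] := pselect (exists i : 'I_M, G i x != 0); last first.
  rewrite big1 ?ler01// => i _; apply/eqP/negPn/negP => Gi.
  by apply: none; exists i.
rewrite (bigD1 i)//= big1 ?addr0; first by have /andP[] := G01 i.
move=> j ji; apply/eqP/negPn/negP => Gj.
have Gne k : G k x != 0 -> exists2 v, w k = Some v & size v = n /\ cylinder v x.
  rewrite /G; case: (w k) => [v|]; last by rewrite eqxx.
  rewrite mulf_eq0 negb_or !pnatr_eq0 !eqb0 !negbK => /andP[/eqP sv /asboolP xv].
  by exists v => //; split => //; rewrite /cylinder /= sv.
have [v wi [sv xv]] := Gne i Gi; have [u wj [su xu]] := Gne j Gj.
have uv : u = v by apply: cylinder_inj xu xv; rewrite su sv.
by move: ji; rewrite -(inj_eq val_inj)/= (winj i j v wi) ?eqxx// -uv.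
Qed.

Lemma sum_geometric_le (r : R) K : 0 <= r < 1 ->
  \sum_(k < K) r ^+ k <= (1 - r)^-1.
Proof.
move=> /andP[r0 r1]; have r1' : 0 < 1 - r by rewrite subr_gt0.
rewrite -[leRHS]mul1r ler_pdivlMr// mulrC.
have -> : (1 - r) * \sum_(k < K) r ^+ k = 1 - r ^+ K.
  by rewrite -opprB mulNr -subrX1 opprB.
by rewrite gerBl exprn_ge0.
Qed.

(** Billingsley's lemma: the cylinders whose mass is at least a power [b] of
    their diameter cover the set arbitrarily deep, and the sum of the powers
    [t > b] of their diameters is dominated, length by length, by a convergent
    geometric series. *)
Lemma hausdorff_dim_le (A : set seqs) (B : R) : 0 <= B ->
  (forall b x N, B < b -> A x ->
    exists2 n, (N <= n)%N & scale m n b <= mass pi p n x) ->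
  (hausdorff_dim A <= B%:E)%E.
Proof.
move=> B0 dense; apply/lee_addgt0Pr => e e0; rewrite -EFinD.
pose t := B + e; have t0 : 0 <= t by rewrite addr_ge0// ltW.
apply: ereal_inf_lbound; exists t => //; split => //.
suff pre0 delta : 0 < delta -> hausdorff_premeasure t delta A = 0%E.
  apply/eqP; rewrite eq_le; apply/andP; split.
    by apply: ge_ereal_sup => _ [d d0 <-]; rewrite pre0.
  by apply: ereal_sup_ubound; exists 1; rewrite ?pre0//= ltr01.
move=> d0; apply/eqP; rewrite eq_le; apply/andP; split; last first.
  apply: le_ereal_inf_tmp => _ [U _ <-]; apply: nneseries_ge0 => i _ _.
  exact: diam_pow_ge0.
(* The surplus [e] over [B] is split: one half pays for [b > B], the other
   provides the ratio [r] of the geometric series over the lengths. *)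
pose r := scale m 1 (e / 2) : R.
have rE n : scale m n (e / 2) = r ^+ n.
  by rewrite /r /scale -expRM_natl mul1r; congr expR; ring.
have r0 : 0 < r by exact: expR_gt0.
have r1 : r < 1.
  rewrite /r /scale -[ltRHS]expR0 ltr_expR oppr_lt0 mul1r mulr_gt0//.
    by rewrite divr_gt0.
  exact: ln_alphabet_gt0.
apply/lee_addgt0Pr => h h0; rewrite add0e.
have e20 : 0 < e / 2 by rewrite divr_gt0.
have r1' : 0 < 1 - r by rewrite subr_gt0.
have [N1 HN1] := scale_small m2 e20 (mulr_gt0 h0 r1').
have [N2 HN2] := scale_small m2 ltr01 d0.
pose N := maxn N1 N2; pose b := B + e / 2.
pose good w := (N <= size w)%N && (scale m (size w) b <= mass pi p (size w) (extend w)).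
pose U i : set seqs := if pickle_inv i is Some w then
  if good w then cylinder w else set0 else set0.
apply: (@le_trans _ _ (\sum_(0 <= i <oo) diam_pow t (U i))%E).
  apply: ereal_inf_lbound; exists U => //; split.
    move=> x Ax; have [|n Nn xn] := dense b x N _ Ax.
      by rewrite ltrDl.
    pose w := mkseq x n.
    have xw : agree_upto x (extend w) n.
      move=> k kn; rewrite /entry /extend /w nth_mkseq//; lia.
    exists (pickle w) => //; rewrite /U pickleK_inv.
    rewrite /good /cylinder size_mkseq Nn -(mass_agree _ _ xw) xn.
    exact: xw.
  move=> i; rewrite /U; case: pickle_inv => [w|]; last first.
    by rewrite /diam setX0 image_set0 ereal_sup0 leNye.
  case: ifPn => [/andP[Nw _]|_]; last first.
    by rewrite /diam setX0 image_set0 ereal_sup0 leNye.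
  apply: le_trans (diam_cylinder w) _; rewrite lee_fin.
  rewrite -[leLHS]powRr1 ?invr_ge0 ?exprn_ge0// powR_inv_exp// HN2//.
  by apply: leq_trans Nw; exact: leq_maxr.
apply: lime_le; first by apply: is_cvg_nneseries => i _ _; exact: diam_pow_ge0.
apply: nearW => M; rewrite big_mkord.
pose len i := if @pickle_inv (seq 'I_m) i is Some w then size w else 0%N.
pose K := (\max_(i < M) len i).+1.
pose c n i : R := if pickle_inv i is Some w then
  (size w == n)%:R * mass pi p n (extend w) else 0.
have c0 n i : 0 <= c n i.
  by rewrite /c; case: pickle_inv => // w; rewrite mulr_ge0 ?mass_ge0.
have term (i : 'I_M) : (diam_pow t (U i) <=
    (\sum_(k < K) r ^+ (N + k) * c (N + k)%N i)%:E)%E.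
  have S0 : (0 <= (\sum_(k < K) r ^+ (N + k) * c (N + k)%N i)%:E)%E.
    by rewrite lee_fin sumr_ge0// => k _; rewrite mulr_ge0 ?exprn_ge0// ltW.
  have dp0 : (diam_pow t (set0 : set seqs) = 0 :> \bar R)%E by rewrite /diam_pow eqxx.
  rewrite /U; case wE : (pickle_inv i) => [w|]; last by rewrite dp0.
  case: ifPn => [/andP[Nw wm]|_]; last by rewrite dp0.
  apply: le_trans (diam_pow_cylinder w t0) _; rewrite lee_fin.
  have wK : (size w - N < K)%N.
    rewrite ltnS (leq_trans (leq_subr _ _))//.
    by have := @leq_bigmax _ (fun i : 'I_M => len i) i; rewrite /len wE.
  have cE : c (size w) i = mass pi p (size w) (extend w).
    by rewrite /c wE eqxx mul1r.
  rewrite (bigD1 (Ordinal wK))//= subnKC// cE.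
  rewrite -[leLHS]addr0 lerD//; last first.
    by apply: sumr_ge0 => k _; rewrite mulr_ge0 ?exprn_ge0 ?(ltW r0).
  have -> : scale m (size w) t = r ^+ size w * scale m (size w) b.
    by rewrite -rE /scale -expRD; congr expR; rewrite /t /b; field.
  by rewrite ler_wpM2l// exprn_ge0// ltW.
apply: (@le_trans _ _ (\sum_(i < M) (\sum_(k < K) r ^+ (N + k) * c (N + k)%N i)%:E)%E).
  by apply: lee_sum => i _; exact: term.
rewrite sumEFin lee_fin exchange_big /=.
apply: (@le_trans _ _ (\sum_(k < K) r ^+ (N + k))).
  apply: ler_sum => k _; rewrite -mulr_sumr -[leRHS]mulr1.
  rewrite ler_wpM2l ?exprn_ge0// ?(ltW r0)//.
  apply: (@sum_mass_le1 (N + k) M pickle_inv) => i j v iv jv.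
  have := pickle_invK (T := seq 'I_m) i; have := pickle_invK (T := seq 'I_m) j.
  by rewrite /= iv jv /= => <- <-.
under eq_bigr do rewrite exprD.
rewrite -mulr_sumr.
apply: (@le_trans _ _ (r ^+ N * (1 - r)^-1)).
  by rewrite ler_wpM2l ?exprn_ge0 ?sum_geometric_le// ?r1 ltW.
rewrite ler_pdivrMr// -rE HN1//; exact: leq_maxl.
Qed.

End CylinderCovers.

Section UpperBound.
Context {R : realType} {m : nat}.
Hypothesis m2 : (2 <= m)%N.
Local Notation seqs := (symbolic_space R m).

(** Otherwise [L n / n] would decrease without bound along [N, 2N, 4N, ...]. *)
Lemma doubling_recurrence (L : nat -> R) C eta N :
  0 < eta -> (forall n, `|L n| <= C * n%:R) ->
  exists2 k, (N <= k)%N & - (eta * k%:R) <= L k.*2 - 2 * L k.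
Proof.
move=> eta0 LC; apply: contrapT => none.
have dec k : (N <= k)%N -> L k.*2 <= 2 * L k - eta * k%:R.
  move=> Nk; rewrite leNgt; apply/negP => lt; apply: none; exists k => //.
  by lra.
pose M := N.+1; have M0 : 0 < M%:R :> R by [].
have iter r : L (2 ^ r * M)%N <= 2 ^+ r * (L M - r%:R * (eta / 2 * M%:R)).
  elim: r => [|r IH]; first by rewrite expn0 mul1n expr0 mul1r mul0r subr0.
  have -> : (2 ^ r.+1 * M = (2 ^ r * M).*2)%N by rewrite expnS -mulnA mul2n.
  have Nk : (N <= 2 ^ r * M)%N.
    by rewrite (leq_trans (leqnSn N))// leq_pmull// expn_gt0.
  apply: le_trans (dec _ Nk) _.
  apply: (@le_trans _ _ (2 * (2 ^+ r * (L M - r%:R * (eta / 2 * M%:R))) -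
      eta * (2 ^ r * M)%:R)).
    by rewrite lerD2r ler_pM2l.
  rewrite natrM natrX -natr1 exprS le_eqVlt; apply/orP; left; apply/eqP.
  by field.
have C0 : 0 <= C.
  have := le_trans (normr_ge0 _) (LC M); rewrite pmulr_lge0//.
pose r := Num.bound (4 * C / eta).
have hr : 4 * C / eta < r%:R by apply: archi_boundP; rewrite divr_ge0 ?mulr_ge0// ltW.
have := iter r; have := LC (2 ^ r * M)%N; rewrite ler_norml => /andP[h _] h2.
have := LC M; rewrite ler_norml => /andP[_ h3].
have p0 : 0 < 2 ^+ r :> R by rewrite exprn_gt0.
move: (le_trans h h2); rewrite natrM natrX mulrCA -mulrN ler_pM2l//.
move: hr; rewrite ltr_pdivrMr// => hr; nra.
Qed.

Variable phi : 'I_m -> 'I_m -> R.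
Variables (s : R) (t : 'I_m -> R).
Hypothesis tP : transfer_system phi s t.

Definition initial_law (j : 'I_m) : R := t j / \sum_i t i.

Definition transition (i j : 'I_m) : R := expR (s * phi i j) * t j / t i ^+ 2.

Lemma transfer_sum_gt0 : 0 < \sum_i t i.
Proof.
case: tP => t0 _; have o : 'I_m by exists 0%N; exact: ltnW.
by rewrite (bigD1 o)//= ltr_pwDl// sumr_ge0// => i _; exact: ltW.
Qed.

Lemma transfer_stochastic : stochastic initial_law transition.
Proof.
have T0 := transfer_sum_gt0; case: tP => t0 tE; split.
- by move=> i; rewrite divr_ge0// ltW.
- by rewrite -mulr_suml divff ?gt_eqF.
- by move=> i j; rewrite !(divr_ge0, mulr_ge0, expR_ge0, exprn_ge0)// ltW.
- by move=> i; rewrite -mulr_suml -tE divff// gt_eqF// exprn_gt0.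
Qed.

(** Each [l <= k] is the source of one transition, with factor [t(x_l)^-2], and
    each [l <= 2k] receives a factor [t(x_l)]. *)
Lemma transfer_mass k (x : seqs) : mass initial_law transition k.*2 x =
  expR (s * \sum_(1 <= l < k.+1) phi (entry x l) (entry x (2 * l))
    - k%:R * ln (\sum_i t i)
    + (\sum_(1 <= l < k.*2.+1) ln (t (entry x l))
       - 2 * \sum_(1 <= l < k.+1) ln (t (entry x l)))).
Proof.
have T0 := transfer_sum_gt0; case: tP => t0 tE.
elim: k => [|k IH].
  by rewrite mass0 !big_geq// !mulr0 mul0r !subr0 addr0 expR0.
rewrite doubleS !massS IH.
rewrite (big_nat_recr k.+1)//= (big_nat_recr k.*2.+2)//= (big_nat_recr k.*2.+1)//=.
rewrite (big_nat_recr k.+1)//=.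
have -> : (2 * k.+1 = k.*2.+2)%N by lia.
rewrite /step /= odd_double /= doubleK /initial_law /transition -[k.+1%:R]natr1.
set A := \sum_(_ <= _ < _) _; set L2 := \sum_(_ <= _ < _) ln _.
set L1 := \sum_(_ <= _ < _) ln _.
set i := entry x k.+1; set j := entry x k.*2.+2; set j' := entry x k.*2.+1.
have -> : s * (A + phi i j) - (k%:R + 1) * ln (\sum_i t i) +
    (L2 + ln (t j') + ln (t j) - 2 * (L1 + ln (t i))) =
    (s * A - k%:R * ln (\sum_i t i) + (L2 - 2 * L1)) +
    ((ln (t j') - ln (\sum_i t i)) + (s * phi i j + ln (t j) - 2 * ln (t i))).
  by ring.
rewrite -[LHS]mulrA [in RHS]expRD; congr (_ * _).
by rewrite !expRD !expRN expRM_natl !lnK ?posrE.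
Qed.

(** On the level set the exponent of the mass is
    [- k (P - s alpha) + o(k) + (L_2k - 2 L_k)], and the last term is bounded
    below by [- eta k] for infinitely many [k]. *)
Lemma level_set_dim_le alpha B : 0 <= B ->
  (ln (\sum_i t i) - s * alpha) / (2 * ln m%:R) <= B ->
  (hausdorff_dim (level_set phi alpha) <= B%:E)%E.
Proof.
move=> B0 hB; have l0 := @ln_alphabet_gt0 R m m2.
have o : 'I_m by exists 0%N; exact: ltnW.
apply: (hausdorff_dim_le m2 transfer_stochastic o) => // b x N Bb xE.
pose eta := (2 * ln m%:R * b - (ln (\sum_i t i) - s * alpha)) / 2.
have eta0 : 0 < eta.
  rewrite divr_gt0// subr_gt0 [ltRHS]mulrC -ltr_pdivrMr ?mulr_gt0//.
  exact: le_lt_trans Bb.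
pose L n := \sum_(1 <= l < n.+1) ln (t (entry x l)).
pose C := \sum_j `|ln (t j)|.
have LC n : `|L n| <= C * n%:R.
  apply: le_trans (ler_norm_sum _ _ _) _.
  apply: (@le_trans _ _ (\sum_(1 <= l < n.+1) C)).
    by apply: ler_sum => l _; rewrite /C (bigD1 (entry x l))//= lerDl sumr_ge0.
  by rewrite sumr_const_nat subn1 mulr_natr.
have s1 : 0 < `|s| + 1 by rewrite ltr_wpDl.
have e0 : 0 < eta / (`|s| + 1) by rewrite divr_gt0.
move: xE; rewrite /level_set /= => /cvgrPdist_le /(_ _ e0) [N1 _ HN1].
have [k kN hk] := @doubling_recurrence L C eta (maxn N N1).+1 eta0 LC.
have k0 : 0 < k%:R :> R by rewrite ltr0n; case: k kN {hk}.
have kmax : (N <= k)%N /\ (N1 <= k)%N by lia.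
exists k.*2; first by lia.
have := HN1 k kmax.2; rewrite /=.
set S := \sum_(_ <= _ < _) _ => hS.
have sS : s * alpha * k%:R - s * S <= eta * k%:R.
  have -> : s * alpha * k%:R - s * S = k%:R * (s * (alpha - k%:R^-1 * S)).
    by field; rewrite gt_eqF.
  rewrite mulrC ler_pM2r// (le_trans (ler_norm _))// normrM.
  apply: le_trans (ler_wpM2l (normr_ge0 s) hS) _.
  rewrite mulrCA -[leRHS]mulr1 ler_pM2l// ler_pdivrMr//.
  by rewrite mul1r lerDl.
rewrite transfer_mass /scale ler_expR -/S -/(L _) -/(L _) -muln2 natrM.
move: hk sS; rewrite -muln2 /eta; lra.
Qed.

End UpperBound.
(** * The transfer system and its stationary frequencies *)

Section TransferSystem.
Context {R : realType} {m : nat}.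

(** The largest subsolution of the system is a solution. *)
Lemma quadratic_system_solvable (A : 'I_m -> 'I_m -> R) :
  (forall i j, 0 < A i j) ->
  exists t : 'I_m -> R, (forall i, 0 < t i) /\
    forall i, t i ^+ 2 = \sum_j A i j * t j.
Proof.
move=> A0; have [m0|/prednK m0] := posnP m.
  by exists (fun=> 0); split=> i; exfalso; have := ltn_ord i; rewrite {2}m0.
have o : 'I_m := cast_ord m0 ord0.
pose B := \sum_i \sum_j A i j.
have AB i j : A i j <= \sum_j A i j.
  by rewrite [leRHS](bigD1 j)//= lerDl sumr_ge0// => k _; exact: ltW.
have rowB i : \sum_j A i j <= B.
  rewrite /B [leRHS](bigD1 i)//= lerDl sumr_ge0// => k _.
  by rewrite sumr_ge0// => l _; exact: ltW.
have B0 : 0 < B by apply: lt_le_trans (A0 o o) (le_trans (AB o o) (rowB o)).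
pose S := \sum_i \sum_j (A i j)^-1.
have AinvS i j : (A i j)^-1 <= S.
  rewrite /S (bigD1 i)//= (bigD1 j)//= -addrA lerDl addr_ge0 ?sumr_ge0//.
    by move=> k _; rewrite invr_ge0 ltW.
  by move=> k _; rewrite sumr_ge0// => l _; rewrite invr_ge0 ltW.
have S0 : 0 < S by apply: lt_le_trans (AinvS o o); rewrite invr_gt0.
pose c := S^-1; have c0 : 0 < c by rewrite invr_gt0.
have cA i j : c <= A i j by rewrite -[leRHS]invrK lef_pV2// posrE invr_gt0.
pose sub (t : 'I_m -> R) := forall i, 0 <= t i <= B /\ t i ^+ 2 <= \sum_j A i j * t j.
pose T i := sup [set t i | t in sub].
have csub : sub (fun=> c).
  move=> i; split; first by rewrite (ltW c0) (le_trans (cA o o) (le_trans (AB o o) (rowB o))).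
  rewrite (bigD1 i)//= -[leLHS]addr0 lerD//; first by rewrite expr2 ler_pM2r.
  by rewrite sumr_ge0// => k _; rewrite mulr_ge0// ltW.
have supT i : has_sup [set t i | t in sub].
  split; first by exists c, (fun=> c).
  by exists B => _ [t /(_ i)[/andP[_ tB] _] <-].
have leT t i : sub t -> t i <= T i.
  by move=> ts; apply: sup_upper_bound => //; exists t.
have geT i v : (forall t, sub t -> t i <= v) -> T i <= v.
  by move=> h; apply: ge_sup; [exact: (supT i).1|move=> _ [t /h + <-]].
have T0 i : 0 < T i by apply: lt_le_trans (leT _ i csub).
have TB i : T i <= B by apply: geT => t /(_ i)[/andP[]].
pose U i := Num.sqrt (\sum_j A i j * T j).
have V0 i : 0 <= \sum_j A i j * T j.
  by rewrite sumr_ge0// => j _; rewrite mulr_ge0// ltW.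
have TU i : T i <= U i.
  apply: geT => t ts; have [/andP[t0 _] tq] := ts i.
  rewrite -(ger0_norm t0) -sqrtr_sqr ler_sqrt//.
  by apply: le_trans tq _; apply: ler_sum => j _; rewrite ler_pM2l// leT.
have Usub : sub U.
  move=> i; split.
    rewrite sqrtr_ge0 /= -(ger0_norm (ltW B0)) -sqrtr_sqr ler_sqrt ?sqr_ge0//.
    apply: (@le_trans _ _ (\sum_j A i j * B)).
      by apply: ler_sum => j _; rewrite ler_pM2l.
    by rewrite -mulr_suml expr2 ler_pM2r.
  by rewrite sqr_sqrtr//; apply: ler_sum => j _; rewrite ler_pM2l.
exists T; split=> // i; rewrite -[RHS]sqr_sqrtr//; congr (_ ^+ 2).
by apply/eqP; rewrite eq_le (TU i) (leT U i Usub).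
Qed.

Lemma transfer_solutionP (phi : 'I_m -> 'I_m -> R) s :
  transfer_system phi s (transfer_solution phi s).
Proof.
rewrite /transfer_solution; case: xgetP => [t -> //|none]; exfalso.
have [|t tP] := @quadratic_system_solvable (fun i j => expR (s * phi i j)).
  by move=> i j; exact: expR_gt0.
exact: (none t).
Qed.

(** The map [t |-> sqrt (A t)] halves logarithmic distances, hence the
    distance of the fixed points is at most twice that of the maps. *)
Lemma transfer_solution_le (phi : 'I_m -> 'I_m -> R) C s s' t t' :
  (forall i j, `|phi i j| <= C) ->
  transfer_system phi s t -> transfer_system phi s' t' ->
  forall i, t' i <= expR (C * `|s' - s|) * t i.
Proof.
move=> phiC [t0 tE] [t'0 tE'] i.
have [k _ kmax] := @arg_maxP _ _ _ i xpredT (fun j => t' j / t j) isT.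
pose r := t' k / t k.
have r0 : 0 < r by rewrite divr_gt0.
have rj j : t' j <= r * t j by rewrite -ler_pdivrMr//; exact: kmax.
suff re : r <= expR (C * `|s' - s|).
  by apply: le_trans (rj i) _; rewrite ler_pM2r.
have : (r * t k) ^+ 2 <= expR (C * `|s' - s|) * r * t k ^+ 2.
  rewrite divfK ?gt_eqF// tE' tE mulr_sumr; apply: ler_sum => j _.
  have -> : expR (C * `|s' - s|) * r * (expR (s * phi k j) * t j) =
    expR (C * `|s' - s|) * expR (s * phi k j) * (r * t j) by ring.
  rewrite ler_pM ?expR_ge0 ?(ltW (t'0 _))// -expRD ler_expR.
  rewrite -lerBlDr -mulrBl (le_trans (ler_norm _))// normrM mulrC.
  by rewrite ler_wpM2r.
by rewrite exprMn ler_pM2r ?exprn_gt0// expr2 ler_pM2r.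
Qed.

End TransferSystem.

Section StationaryFrequencies.
Context {R : realType} {m : nat}.
Variables (pi : 'I_m -> R) (p : 'I_m -> 'I_m -> R).
Hypothesis st : stochastic pi p.

Definition frequency (j : 'I_m) : R :=
  ((\row_i pi i) *m invmx (2%:M - \matrix_(i, k) p i k)) ord0 j.

(** Transport by a stochastic matrix does not increase sums of absolute values,
    so half of it is a contraction. *)
Lemma frequency_contraction (v w : 'I_m -> R) :
  (forall j, 2 * v j = w j + \sum_i v i * p i j) ->
  \sum_j `|v j| <= \sum_j `|w j|.
Proof.
move=> vE; suff : \sum_j 2 * `|v j| <= \sum_j `|w j| + \sum_j `|v j|.
  by rewrite -mulr_sumr; lra.
have -> : \sum_j `|v j| = \sum_j \sum_i `|v i| * p i j.
  rewrite exchange_big; apply: eq_bigr => i _ /=; rewrite -mulr_sumr.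
  by case: st => _ _ _ ->; rewrite mulr1.
rewrite -big_split; apply: ler_sum => j _ /=.
rewrite -(@gtr0_norm _ 2)// -normrM vE (le_trans (ler_normD _ _))// lerD2l.
apply: le_trans (ler_norm_sum _ _ _) _; apply: ler_sum => i _.
by rewrite normrM (ger0_norm (_ : 0 <= p i j))//; case: st.
Qed.

Lemma frequencyE j : 2 * frequency j = pi j + \sum_i frequency i * p i j.
Proof.
set M := 2%:M - \matrix_(i, k) p i k.
have Mv (v : 'rV[R]_m) k : (v *m M) ord0 k = 2 * v ord0 k - \sum_i v ord0 i * p i k.
  rewrite mulmxBr !mxE; congr (_ - _).
    rewrite (bigD1 k)//= mxE eqxx mulrC mulr1n big1 ?addr0// => i ik.
    by rewrite mxE (negbTE ik) mulr0n mulr0.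
  by apply: eq_bigr => i _; rewrite mxE.
have uM : M \in unitmx.
  rewrite -row_free_unit; apply: inj_row_free => v vM.
  have : \sum_k `|v ord0 k| <= \sum_(k < m) `|0 : R|.
    apply: frequency_contraction => k; have := Mv v k.
    by rewrite vM mxE add0r => /esym/eqP; rewrite subr_eq0 => /eqP.
  rewrite [leRHS]big1 => [h|i _]; last by rewrite normr0.
  apply/rowP => k; rewrite mxE; apply/eqP; rewrite -normr_le0.
  by apply: le_trans h; rewrite (bigD1 k)//= lerDl sumr_ge0.
have := Mv ((\row_i pi i) *m invmx M) j.
by rewrite mulmxKV// mxE => ->; rewrite subrK.
Qed.

Lemma sum_frequency : \sum_j frequency j = 1.
Proof.
have : \sum_j 2 * frequency j = 1 + \sum_j frequency j.
  under eq_bigr do rewrite frequencyE.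
  rewrite big_split exchange_big /=; case: st => _ -> _ p1; congr (_ + _).
  by apply: eq_bigr => i _; rewrite -mulr_sumr p1 mulr1.
by rewrite -mulr_sumr; lra.
Qed.

Lemma frequency_ge j : pi j / 2 <= frequency j.
Proof.
have f0 i : 0 <= frequency i.
  rewrite leNgt; apply/negP => fi.
  have := frequency_contraction frequencyE.
  have -> : \sum_j `|pi j| = 1.
    by case: st => a <- _ _; apply: eq_bigr => k _; rewrite ger0_norm.
  rewrite -sum_frequency leNgt => /negP; apply.
  rewrite [ltLHS](bigD1 i)//= [ltRHS](bigD1 i)//= ltr_leD//.
    by rewrite (lt_le_trans fi).
  by apply: ler_sum => k _; exact: ler_norm.
have := frequencyE j; have : 0 <= \sum_i frequency i * p i j.
  by rewrite sumr_ge0// => i _; rewrite mulr_ge0//; case: st.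
by rewrite ler_pdivrMr//; lra.
Qed.

(** Summation by parts: the frequencies are dual to the chain. *)
Lemma frequency_dual (d : 'I_m -> R) :
  \sum_j pi j * d j = \sum_i frequency i * (2 * d i - \sum_j p i j * d j).
Proof.
have -> : \sum_j pi j * d j = \sum_j (2 * frequency j - \sum_i frequency i * p i j) * d j.
  by apply: eq_bigr => j _; rewrite frequencyE addrK.
under [LHS]eq_bigr do rewrite mulrBl mulr_suml.
under [RHS]eq_bigr do rewrite mulrBr mulr_sumr.
rewrite !sumrB [in LHS]exchange_big /=; congr (_ - _).
  by apply: eq_bigr => i _; ring.
by apply: eq_bigr => i _; apply: eq_bigr => j _; rewrite mulrA.
Qed.

End StationaryFrequencies.

Lemma frequency_lipschitz {R : realType} {m : nat} (pi pi' : 'I_m -> R) p p' :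
  stochastic pi p -> stochastic pi' p' ->
  \sum_j `|frequency pi p j - frequency pi' p' j| <=
    \sum_j `|pi j - pi' j| + \sum_j \sum_i `|p i j - p' i j|.
Proof.
move=> st st'; rewrite -big_split /=.
set q := frequency pi p; set q' := frequency pi' p'.
have q'1 i : `|q' i| <= 1.
  have q'0 k : 0 <= q' k.
    apply: le_trans (frequency_ge st' k).
    by case: st' => a _ _ _; rewrite divr_ge0.
  by rewrite ger0_norm// -(sum_frequency st') (bigD1 i)//= lerDl sumr_ge0.
apply: (@le_trans _ _ (\sum_j `|pi j - pi' j + \sum_i q' i * (p i j - p' i j)|)).
  apply: (frequency_contraction st) => j; rewrite mulrBr.
  rewrite (frequencyE st) (frequencyE st') -/q -/q'.
  have -> : \sum_i (q i - q' i) * p i j = \sum_i q i * p i j - \sum_i q' i * p i j.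
    by rewrite -sumrB; apply: eq_bigr => i _; rewrite mulrBl.
  have -> : \sum_i q' i * (p i j - p' i j) = \sum_i q' i * p i j - \sum_i q' i * p' i j.
    by rewrite -sumrB; apply: eq_bigr => i _; rewrite mulrBr.
  by ring.
apply: ler_sum => j _; apply: le_trans (ler_normD _ _) _; rewrite lerD2l.
apply: le_trans (ler_norm_sum _ _ _) _; apply: ler_sum => i _.
by rewrite normrM ler_piMl.
Qed.
(** * The pressure and its derivative *)

Lemma cvg_sumr {R : realType} {T : Type} {F : set_system T} {FF : Filter F}
    {I : finType} (f : I -> T -> R) (l : I -> R) :
  (forall i, f i x @[x --> F] --> l i) ->
  \sum_i f i x @[x --> F] --> \sum_i l i.
Proof. by move=> fl; apply: cvg_big => //; exact: add_continuous. Qed.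

Section Jensen.
Context {R : realType} {I : finType}.
Variables (w z : I -> R).
Hypothesis w1 : \sum_i w i = 1.

Let mean_shift : \sum_i w i * (1 + (z i - \sum_j w j * z j)) = 1.
Proof.
under eq_bigr do rewrite mulrDr mulrBr mulr1.
by rewrite big_split sumrB /= -mulr_suml w1 mul1r subrr addr0.
Qed.

Let factor : \sum_i w i * expR (z i) =
  expR (\sum_j w j * z j) * \sum_i w i * expR (z i - \sum_j w j * z j).
Proof.
rewrite mulr_sumr; apply: eq_bigr => i _; rewrite mulrCA; congr (_ * _).
by rewrite -expRD; congr expR; ring.
Qed.

Lemma jensen_expR : (forall i, 0 <= w i) ->
  expR (\sum_j w j * z j) <= \sum_i w i * expR (z i).
Proof.
move=> w0; rewrite factor -[leLHS]mulr1 ler_pM2l ?expR_gt0// -[leLHS]mean_shift.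
by apply: ler_sum => i _; rewrite ler_wpM2l// expR_ge1Dx.
Qed.

Lemma jensen_expR_eq : (forall i, 0 < w i) ->
  expR (\sum_j w j * z j) = \sum_i w i * expR (z i) ->
  forall i, z i = \sum_j w j * z j.
Proof.
move=> w0 E i; apply/eqP; rewrite -subr_eq0; apply/negPn/negP => zi.
have := lexx (expR (\sum_j w j * z j)).
rewrite {1}E factor -[leRHS]mulr1 ler_pM2l ?expR_gt0// leNgt => /negP; apply.
rewrite -[ltLHS]mean_shift (bigD1 i)//= [ltRHS](bigD1 i)//= ltr_leD//.
  by rewrite ltr_pM2l// expR_gt1Dx.
by apply: ler_sum => j _; rewrite ler_wpM2l ?expR_ge1Dx// ltW.
Qed.

End Jensen.

Section Pressure.
Context {R : realType} {m : nat}.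
Hypothesis m2 : (2 <= m)%N.
Variable phi : 'I_m -> 'I_m -> R.
Implicit Type s : R.

Let t s : 'I_m -> R := transfer_solution phi s.

Definition gibbs_law s : 'I_m -> R := initial_law (t s).
Definition gibbs_transition s : 'I_m -> 'I_m -> R := transition phi s (t s).
Definition gibbs_frequency s : 'I_m -> R :=
  frequency (gibbs_law s) (gibbs_transition s).
Definition gibbs_mean s : R :=
  \sum_i gibbs_frequency s i * \sum_j gibbs_transition s i j * phi i j.

Local Notation pi := gibbs_law.
Local Notation p := gibbs_transition.
Local Notation q := gibbs_frequency.
Local Notation P := (pressure phi).

Let t_gt0 s j : 0 < t s j.
Proof. by have [h _] := transfer_solutionP phi s. Qed.

Let tE s i : t s i ^+ 2 = \sum_j expR (s * phi i j) * t s j.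
Proof. by have [_ h] := transfer_solutionP phi s. Qed.

Let T_gt0 s : 0 < \sum_j t s j.
Proof. exact: (transfer_sum_gt0 m2 (transfer_solutionP phi s)). Qed.

Lemma gibbs_stochastic s : stochastic (pi s) (p s).
Proof. exact: (transfer_stochastic m2 (transfer_solutionP phi s)). Qed.

Let pi_gt0 s j : 0 < pi s j.
Proof. by rewrite divr_gt0. Qed.

Let p_gt0 s i j : 0 < p s i j.
Proof. by rewrite divr_gt0 ?mulr_gt0 ?expR_gt0 ?exprn_gt0. Qed.

Lemma gibbs_frequencyE s j : 2 * q s j = pi s j + \sum_i q s i * p s i j.
Proof. exact/frequencyE/gibbs_stochastic. Qed.

Let q_gt0 s j : 0 < q s j.
Proof.
apply: lt_le_trans (frequency_ge (gibbs_stochastic s) j).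
by rewrite divr_gt0.
Qed.

Section TwoParameters.
Variables s s' : R.

Let d i := ln (t s' i) - ln (t s i).
Let z i j := (s' - s) * phi i j + d j.

Let expR_d i : expR (d i) = t s' i / t s i.
Proof. by rewrite /d expRD expRN !lnK ?posrE. Qed.

Let row_ratio i : expR (2 * d i) = \sum_j p s i j * expR (z i j).
Proof.
rewrite expRM_natl expR_d expr_div_n tE mulr_suml; apply: eq_bigr => j _.
rewrite /z expRD expR_d mulrBl expRD expRN /p /transition; field.
by rewrite !gt_eqF ?expR_gt0.
Qed.

Let law_ratio : expR (P s' - P s) = \sum_j pi s j * expR (d j).
Proof.
rewrite expRD expRN /pressure -/(t s) -/(t s') !lnK ?posrE// mulr_suml.
apply: eq_bigr => j _; rewrite expR_d /pi /initial_law; field.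
by rewrite !gt_eqF.
Qed.

Let d_le i : \sum_j p s i j * z i j <= 2 * d i.
Proof.
rewrite -ler_expR; have [_ _ p0 p1] := gibbs_stochastic s.
by rewrite row_ratio; exact: jensen_expR.
Qed.

Let pressure_le : \sum_j pi s j * d j <= P s' - P s.
Proof.
rewrite -ler_expR; have [pi0 pi1 _ _] := gibbs_stochastic s.
by rewrite law_ratio; exact: jensen_expR.
Qed.

Let gap : \sum_j pi s j * d j = (s' - s) * gibbs_mean s +
  \sum_i q s i * (2 * d i - \sum_j p s i j * z i j).
Proof.
rewrite (frequency_dual (gibbs_stochastic s)) /gibbs_mean mulr_sumr -big_split.
apply: eq_bigr => i _ /=.
have -> : \sum_j p s i j * z i j = (s' - s) * \sum_j p s i j * phi i j
    + \sum_j p s i j * d j.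
  by rewrite mulr_sumr -big_split; apply: eq_bigr => j _; rewrite /z /=; ring.
by rewrite -/(q s i); ring.
Qed.

Let gap_ge0 i : 0 <= q s i * (2 * d i - \sum_j p s i j * z i j).
Proof. by rewrite mulr_ge0 ?(ltW (q_gt0 _ _))// subr_ge0 d_le. Qed.

(** The Gibbs mean is a subgradient of the pressure: the two applications of
    Jensen's inequality, one for the initial law and one for each row of the
    transition matrix, add up with the weights of the frequencies. *)
Lemma pressure_subgradient : P s + (s' - s) * gibbs_mean s <= P s'.
Proof.
rewrite -lerBrDl; apply: le_trans pressure_le; rewrite gap lerDl.
by apply: sumr_ge0 => i _; exact: gap_ge0.
Qed.

(** Equality makes the exponents constant, first in the initial law, then in
    the rows of the transition matrix. *)
Lemma pressure_subgradient_strict : s != s' ->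
  (~ exists c : R, forall i j : 'I_m, phi i j = c) ->
  P s + (s' - s) * gibbs_mean s < P s'.
Proof.
move=> ss' nc; rewrite lt_neqAle pressure_subgradient andbT.
apply/eqP => E; apply: nc.
have S0 : 0 <= \sum_i q s i * (2 * d i - \sum_j p s i j * z i j).
  by apply: sumr_ge0 => i _; exact: gap_ge0.
have E1 : \sum_j pi s j * d j = P s' - P s.
  by have := pressure_le; have := gap; lra.
have E2 : \sum_i q s i * (2 * d i - \sum_j p s i j * z i j) = 0.
  by have := gap; lra.
have [pi0 pi1 _ p1] := gibbs_stochastic s.
have dc i : d i = \sum_j pi s j * d j.
  apply: jensen_expR_eq => //.
  by rewrite E1 law_ratio.
set D := \sum_j pi s j * d j in dc.
have z2 i : \sum_j p s i j * z i j = 2 * d i.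
  have /eqP : q s i * (2 * d i - \sum_j p s i j * z i j) = 0.
    by apply: (psumr_eq0P _ E2) => // k _; exact: gap_ge0.
  by rewrite mulf_eq0 gt_eqF//= subr_eq0 => /eqP.
have zc i j : z i j = 2 * d i.
  rewrite -z2; apply: jensen_expR_eq => //.
  by rewrite z2 row_ratio.
exists (D / (s' - s)) => i j.
have s0 : s' - s != 0 by rewrite subr_eq0 eq_sym.
apply: (mulfI s0); rewrite mulrCA mulfV// mulr1.
by have := zc i j; rewrite /z !dc; lra.
Qed.

End TwoParameters.

Lemma gibbs_mean_increasing s s' :
  (~ exists c : R, forall i j : 'I_m, phi i j = c) ->
  s < s' -> gibbs_mean s < gibbs_mean s'.
Proof.
move=> nc ss'.
have h1 := pressure_subgradient_strict (negbT (lt_eqF ss')) nc.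
have h2 := pressure_subgradient s' s.
have d0 : 0 < s' - s by rewrite subr_gt0.
rewrite -(ltr_pM2l d0); lra.
Qed.

(** The logarithms of the Gibbs weights are affine in [phi] and [ln t], and the
    terms in [ln t] cancel by duality of the frequencies. *)
Lemma gibbs_entropy s : entropy (pi s) (p s) (q s) = (P s - s * gibbs_mean s) / 2.
Proof.
have [pi0 pi1 _ p1] := gibbs_stochastic s.
rewrite /entropy; congr (_ / _).
have -> : \sum_j pi s j * ln (pi s j) = \sum_j pi s j * ln (t s j) - P s.
  rewrite -[X in _ - X]mul1r -pi1 mulr_suml -sumrB; apply: eq_bigr => j _.
  by rewrite -mulrBr {2}/pi /initial_law lnM ?posrE ?invr_gt0// lnV ?posrE.
rewrite (frequency_dual (gibbs_stochastic s)) -/(q s).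
have -> : \sum_i q s i * \sum_j p s i j * ln (p s i j) = s * gibbs_mean s -
    \sum_i q s i * (2 * ln (t s i) - \sum_j p s i j * ln (t s j)).
  rewrite /gibbs_mean mulr_sumr -sumrB; apply: eq_bigr => i _.
  rewrite mulrCA -mulrBr; congr (_ * _).
  have -> : 2 * ln (t s i) = \sum_j p s i j * (2 * ln (t s i)).
    by rewrite -mulr_suml p1 mul1r.
  rewrite -sumrB mulr_sumr -sumrB; apply: eq_bigr => j _.
  rewrite {2}/p /transition lnM ?posrE ?mulr_gt0 ?expR_gt0 ?invr_gt0 ?exprn_gt0//.
  rewrite lnV ?posrE ?exprn_gt0// lnM ?posrE ?expR_gt0// expRK lnXn//; ring.
by ring.
Qed.

Let t_continuous j s : t s' j @[s' --> s] --> t s j.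
Proof.
pose C := 1 + \sum_i \sum_j `|phi i j|.
have phiC i k : `|phi i k| <= C.
  apply: (@le_trans _ _ (\sum_i \sum_j `|phi i j|)); last by rewrite lerDr.
  rewrite (bigD1 i)//= (bigD1 k)//= -addrA lerDl addr_ge0 ?sumr_ge0//.
  by move=> l _; rewrite sumr_ge0.
have C0 : 0 < C.
  by rewrite ltr_pwDl// sumr_ge0// => i _; rewrite sumr_ge0.
have lnt s' : `|ln (t s j) - ln (t s' j)| <= C * `|s - s'|.
  have h u v : ln (t u j) - ln (t v j) <= C * `|u - v|.
    rewrite lerBlDr -ler_expR expRD !lnK ?posrE//.
    exact: transfer_solution_le (transfer_solutionP _ _) (transfer_solutionP _ _) j.
  rewrite ler_norml h andbT lerNl opprB (le_trans (h _ _))//.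
  by rewrite distrC.
have ct : ln (t s' j) @[s' --> s] --> ln (t s j).
  apply/cvgrPdist_le => e e0; near=> s'.
  apply: le_trans (lnt s') _; rewrite -ler_pdivlMl//.
  near: s'; apply: cvgr_dist_le; first exact: cvg_id.
  by rewrite mulr_gt0// invr_gt0.
rewrite -[t s j]lnK ?posrE//.
have -> : t ^~ j = expR \o (fun s' => ln (t s' j)).
  by apply/funext => s' /=; rewrite lnK ?posrE.
exact: (cvg_comp _ _ ct (@continuous_expR R _)).
Unshelve. all: by end_near.
Qed.

Let pi_continuous j s : pi s' j @[s' --> s] --> pi s j.
Proof.
apply: cvgM; first exact: t_continuous.
by apply: cvgV; [rewrite gt_eqF|apply: cvg_sumr => k; exact: t_continuous].
Qed.

Let p_continuous i j s : p s' i j @[s' --> s] --> p s i j.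
Proof.
apply: cvgM.
  apply: cvgM; last exact: t_continuous.
  have cl : s' * phi i j @[s' --> s] --> s * phi i j.
    by apply: cvgM; [exact: cvg_id|exact: cvg_cst].
  exact: (cvg_comp _ _ cl (@continuous_expR R _)).
apply: cvgV; first by rewrite gt_eqF// exprn_gt0.
by apply: cvgM; exact: t_continuous.
Qed.

Let q_continuous j s : q s' j @[s' --> s] --> q s j.
Proof.
pose F s' := \sum_j `|pi s j - pi s' j| + \sum_j \sum_i `|p s i j - p s' i j|.
have F0 : F s' @[s' --> s] --> 0.
  have -> : 0 = \sum_j `|pi s j - pi s j| + \sum_j \sum_i `|p s i j - p s i j|.
    rewrite big1 ?add0r ?big1// => [k _|k _]; last by rewrite subrr normr0.
    by rewrite big1// => i _; rewrite subrr normr0.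
  apply: cvgD; apply: cvg_sumr => k.
    by apply: cvg_norm; apply: cvgB; [exact: cvg_cst|exact: pi_continuous].
  apply: cvg_sumr => i; apply: cvg_norm; apply: cvgB; first exact: cvg_cst.
  exact: p_continuous.
apply/cvgrPdist_le => e e0; near=> s'.
apply: (@le_trans _ _ (F s')).
  apply: le_trans (frequency_lipschitz (gibbs_stochastic s) (gibbs_stochastic s')).
  by rewrite (bigD1 j)//= lerDl sumr_ge0.
rewrite -[F s']opprK -[- F s']add0r; apply: le_trans (ler_norm _) _; rewrite normrN.
by near: s'; apply: cvgr_dist_le.
Unshelve. all: by end_near.
Qed.

Lemma gibbs_mean_continuous s : gibbs_mean s' @[s' --> s] --> gibbs_mean s.
Proof.
apply: cvg_sumr => i; apply: cvgM; first exact: q_continuous.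
apply: cvg_sumr => j; apply: cvgM; first exact: p_continuous.
exact: cvg_cst.
Qed.

(** A convex function with a continuous subgradient is differentiable. *)
Lemma dpressureE s : dpressure phi s = gibbs_mean s.
Proof.
rewrite /dpressure /derive1; apply: cvg_lim => //.
apply/cvgrPdist_le => e e0.
have /cvgrPdist_le/(_ e e0) [r /= r0 hr] := @gibbs_mean_continuous s.
exists r => // h /=; rewrite sub0r normrN => hr' h0.
have hs : ball_ Num.norm s r (h + s).
  by rewrite /= opprD addrCA subrr addr0 normrN.
apply: le_trans (hr _ hs).
have h1 := pressure_subgradient s (h + s); have h2 := pressure_subgradient (h + s) s.
rewrite addrK in h1; rewrite opprD addrCA subrr addr0 in h2.
set D := P (h + s) - P s; rewrite -[_ *: _]/(h^-1 * D).
set u := gibbs_mean s in h1 *; set v := gibbs_mean (h + s) in h2 *.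
have DE : D = h * (h^-1 * D) by rewrite mulrA divff// mul1r.
move: DE; move: (h^-1 * D) => w DE.
have b1 : h * u <= h * w by rewrite -DE /D; lra.
have b2 : h * w <= h * v by rewrite -DE /D; lra.
move: h0; rewrite neq_lt => /orP[h0|h0].
  move: b1 b2; rewrite !ler_nM2l// => b1 b2.
  by rewrite !ger0_norm ?subr_ge0 ?(le_trans b2)//; lra.
move: b1 b2; rewrite !ler_pM2l// => b1 b2.
by rewrite !ler0_norm ?subr_le0 ?(le_trans b1)//; lra.
Qed.

End Pressure.
(** * Limits of Gibbs chains and the endpoints of the spectrum *)

Section Limits.
Context {R : realType}.

(** At [0] the bound [|x ln x| <= 2 sqrt x] replaces the continuity of [ln]. *)
Lemma cvg_xlnx {T : Type} {F : set_system T} {FF : Filter F} (h : T -> R) l :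
  (forall x, 0 <= h x <= 1) -> h x @[x --> F] --> l -> 0 <= l ->
  h x * ln (h x) @[x --> F] --> l * ln l.
Proof.
move=> h01 hl; rewrite le_eqVlt => /predU1P[l0|l0]; last first.
  apply: cvgM => //; exact: (cvg_comp _ _ hl (continuous_ln l0)).
rewrite -l0 mul0r; rewrite -l0 in hl.
have bound x : `|h x * ln (h x)| <= 2 * Num.sqrt (h x).
  have /andP[] := h01 x; rewrite le_eqVlt => /predU1P[<-|hx] h1.
    by rewrite mul0r normr0 mulr_ge0 ?sqrtr_ge0.
  pose u := Num.sqrt (h x).
  have u0 : 0 < u by rewrite sqrtr_gt0.
  have hE : h x = u ^+ 2 by rewrite sqr_sqrtr// ltW.
  rewrite ler0_norm; last by rewrite mulr_ge0_le0 ?(ltW hx)// ln_le0.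
  rewrite hE sqrtr_sqr (gtr0_norm u0) lnXn// -mulrN.
  have := ln_sublinear (_ : 0 < u^-1); rewrite invr_gt0 lnV ?posrE// => /(_ u0) hu.
  have : u ^+ 2 * (- ln u) <= u ^+ 2 * u^-1 by rewrite ler_wpM2l ?sqr_ge0// ltW.
  rewrite expr2 mulfK ?gt_eqF// mulr2n; lra.
have c0 : 2 * Num.sqrt (h x) @[x --> F] --> (0 : R).
  rewrite -(mulr0 2) -[X in 2 * X]sqrtr0; apply: cvgM; first exact: cvg_cst.
  exact: (cvg_comp _ _ hl (@sqrt_continuous R 0)).
apply/cvgr0Pnorm_le => e e0.
move/cvgr0Pnorm_le : c0 => /(_ e e0); apply: filterS => x.
rewrite ger0_norm; last by rewrite mulr_ge0 ?sqrtr_ge0.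
exact: le_trans.
Qed.

Lemma ultra_cvg {T : Type} {U : set_system T} {UU : UltraFilter U} (h : T -> R) :
  (forall x, 0 <= h x <= 1) -> exists l : R, h x @[x --> U] --> l.
Proof.
move=> h01; have UP : ProperFilter U by exact: ultra_proper.
have [|l [_ cl]] := @segment_compact R 0 1 (h @ U) _.
  by rewrite /fmap /=; apply: filterE => x; rewrite /= in_itv; exact: h01.
exists l => B Bl; have [//|nB] := in_ultra_setVsetC (h @^-1` B) UU.
by have [x [/= nBx /nBx]] := cl (~` B) B nB Bl.
Qed.

End Limits.

Section Endpoints.
Context {R : realType} {m : nat}.
Hypothesis m2 : (2 <= m)%N.
Variable phi : 'I_m -> 'I_m -> R.

Lemma entropy_ge0 (pi : 'I_m -> R) p q : stochastic pi p ->
  (forall i, 0 <= q i) -> 0 <= entropy pi p q.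
Proof.
move=> [pi0 pi1 p0 p1] q0.
have le1 (w : 'I_m -> R) i : (forall i, 0 <= w i) -> \sum_i w i = 1 -> w i <= 1.
  by move=> w0 <-; rewrite (bigD1 i)//= lerDl sumr_ge0.
have xlnx (w : 'I_m -> R) i : (forall i, 0 <= w i) -> \sum_i w i = 1 ->
    w i * ln (w i) <= 0.
  by move=> w0 w1; rewrite mulr_ge0_le0// ln_le0// le1.
rewrite /entropy mulNr oppr_ge0 mulr_le0_ge0// -[leRHS]addr0 lerD//.
  by apply: sumr_le0 => i _; exact: xlnx.
apply: sumr_le0 => i _; rewrite mulr_ge0_le0//.
by apply: sumr_le0 => j _; exact: xlnx.
Qed.

Lemma gibbs_frequency_ge0 s i : 0 <= gibbs_frequency phi s i.
Proof.
have st := gibbs_stochastic m2 phi s.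
by apply: le_trans (frequency_ge st i); case: st => h _ _ _; rewrite divr_ge0.
Qed.

Lemma dim_formulaE s : dim_formula phi s =
  entropy (gibbs_law phi s) (gibbs_transition phi s) (gibbs_frequency phi s) / ln m%:R.
Proof.
rewrite gibbs_entropy// /dim_formula dpressureE//.
by field; rewrite gt_eqF// ln_alphabet_gt0.
Qed.

Lemma dim_formula_ge0 s : 0 <= dim_formula phi s.
Proof.
rewrite dim_formulaE divr_ge0//; last exact/ltW/ln_alphabet_gt0.
by apply: entropy_ge0; [exact: gibbs_stochastic|exact: gibbs_frequency_ge0].
Qed.

(** The bounds [P s - s alpha] and [P s - s P'(s)] differ by
    [s (alpha - P'(s))], whose sign is right at both ends of the spectrum. *)
Lemma level_set_dim_le_formula s alpha :
  0 <= s * (alpha - dpressure phi s) ->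
  (hausdorff_dim (level_set phi alpha) <= (dim_formula phi s)%:E)%E.
Proof.
move=> h; apply: (level_set_dim_le m2 (transfer_solutionP phi s)).
  exact: dim_formula_ge0.
have l0 := @ln_alphabet_gt0 R m m2.
rewrite /dim_formula mulrC ler_pM2l ?invr_gt0 ?mulr_gt0//.
by rewrite -/(pressure phi s); lra.
Qed.

Lemma level_set_dim_eq s : hausdorff_dim (level_set phi (dpressure phi s)) =
  (dim_formula phi s)%:E.
Proof.
apply/eqP; rewrite eq_le level_set_dim_le_formula ?subrr ?mulr0//=.
rewrite dim_formulaE; apply: level_set_dim_ge => //.
- exact: gibbs_stochastic.
- exact: gibbs_frequencyE.
- exact: dpressureE.
Qed.

(** The formula bounds the dimension from above along [F].  If it stayed
    away from the dimension, then along some ultrafilter the Gibbs chains would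
    converge to a chain, possibly with zero probabilities, of mean [alpha] and
    entropy exceeding what the lower bound allows. *)
Lemma level_set_dim_cvg (F : set_system R) {FF : ProperFilter F} alpha :
  dpressure phi s @[s --> F] --> alpha ->
  (\forall s \near F, 0 <= s * (alpha - dpressure phi s)) ->
  (dim_formula phi s)%:E @[s --> F] --> hausdorff_dim (level_set phi alpha).
Proof.
move=> cva sa; set D := hausdorff_dim _.
have DF : \forall s \near F, (D <= (dim_formula phi s)%:E)%E.
  by apply: filterS sa => s; exact: level_set_dim_le_formula.
have D0 : (0 <= D)%E.
  by apply: le_ereal_inf_tmp => _ [s [s0 _] <-]; rewrite lee_fin.
have [s0 Ds0] := filter_ex DF.
have [r DE] : exists r, D = r%:E.
  by exists (fine D); rewrite fineK// ge0_fin_numE// (le_lt_trans Ds0)// ltry.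
rewrite DE; rewrite DE in DF.
suff cr : dim_formula phi s @[s --> F] --> r.
  by apply: cvg_EFin; [exact: nearW|exact: cr].
apply/cvgrPdist_le => e e0; apply: contrapT => nF.
pose far := [set s | ~ `|r - dim_formula phi s| <= e].
have farP : ProperFilter (within far F).
  apply: Build_ProperFilter => h; apply: nF; near=> s; apply: contrapT.
  by have : far s -> set0 s by near: s.
have [U [UU FU]] := ultraFilterLemma farP.
have UP : ProperFilter U by exact: ultra_proper.
have FUs A : F A -> U A.
  by move=> FA; apply: FU; apply: filterS FA => s As _.
have Ufar : U far by apply: FU; rewrite /within /=; exact: nearW.
have le1 (w : 'I_m -> R) i : (forall i, 0 <= w i) -> \sum_i w i = 1 -> w i <= 1.
  by move=> w0 <-; rewrite (bigD1 i)//= lerDl sumr_ge0.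
have st s := gibbs_stochastic m2 phi s.
have pi01 i s : 0 <= gibbs_law phi s i <= 1.
  by have [h0 h1 _ _] := st s; rewrite h0 le1.
have p01 i j s : 0 <= gibbs_transition phi s i j <= 1.
  by have [_ _ h0 h1] := st s; rewrite h0 le1.
have q01 i s : 0 <= gibbs_frequency phi s i <= 1.
  rewrite gibbs_frequency_ge0 le1// => [k|]; first exact: gibbs_frequency_ge0.
  exact/sum_frequency/st.
have [pi piP] := choice (fun i => ultra_cvg (UU := UU) (pi01 i)).
have [p pP] := choice (fun ij : 'I_m * 'I_m => ultra_cvg (UU := UU) (p01 ij.1 ij.2)).
have [q qP] := choice (fun i => ultra_cvg (UU := UU) (q01 i)).
have lim_eq (f g : R -> R) (a b : R) : f s @[s --> U] --> a -> g s @[s --> U] --> b ->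
    f =1 g -> a = b.
  move=> fa gb /funext fg; rewrite fg in fa.
  exact: (cvg_unique (@norm_hausdorff _ R) fa gb).
have stU : stochastic pi (fun i j => p (i, j)).
  split.
  - by move=> i; apply: (cvgr_to_ge (piP i)); apply: nearW => s; have /andP[] := pi01 i s.
  - apply: (lim_eq (fun s => \sum_i gibbs_law phi s i) (fun=> 1)).
    + exact: cvg_sumr.
    + exact: cvg_cst.
    + by move=> s; have [_ h _ _] := st s.
  - move=> i j; apply: (cvgr_to_ge (pP (i, j))); apply: nearW => s.
    by have /andP[] := p01 i j s.
  - move=> i.
    apply: (lim_eq (fun s => \sum_j gibbs_transition phi s i j) (fun=> 1)).
    + by apply: cvg_sumr => j; exact: (pP (i, j)).
    + exact: cvg_cst.
    + by move=> s; have [_ _ _ h] := st s.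
have qU j : 2 * q j = pi j + \sum_i q i * p (i, j).
  apply: (lim_eq (fun s => 2 * gibbs_frequency phi s j) (fun s => gibbs_law phi s j
      + \sum_i gibbs_frequency phi s i * gibbs_transition phi s i j)).
  - by apply: cvgM; [exact: cvg_cst|exact: qP].
  - apply: cvgD; first exact: piP.
    by apply: cvg_sumr => i; apply: cvgM; [exact: qP|exact: (pP (i, j))].
  - by move=> s; exact: gibbs_frequencyE.
have aU : alpha = \sum_i q i * \sum_j p (i, j) * phi i j.
  apply: (lim_eq (dpressure phi) (gibbs_mean phi)); last exact: dpressureE.
    exact: cvg_trans (cvg_app _ FUs) cva.
  apply: cvg_sumr => i; apply: cvgM; first exact: qP.
  apply: cvg_sumr => j; apply: cvgM; first exact: (pP (i, j)).
  exact: cvg_cst.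
have eU : dim_formula phi s @[s --> U] --> entropy pi (fun i j => p (i, j)) q / ln m%:R.
  have -> : dim_formula phi = fun s => entropy (gibbs_law phi s)
      (gibbs_transition phi s) (gibbs_frequency phi s) / ln m%:R.
    by apply/funext => s; exact: dim_formulaE.
  apply: cvgM; last exact: cvg_cst.
  apply: cvgM; last exact: cvg_cst.
  apply: cvgN; apply: cvgD; apply: cvg_sumr => i.
    by apply: cvg_xlnx => //; case: stU.
  apply: cvgM; first exact: qP.
  apply: cvg_sumr => j; apply: cvg_xlnx; [exact: p01|exact: (pP (i, j))|].
  by case: stU.
have := level_set_dim_ge m2 stU qU aU.
rewrite -/D DE lee_fin leNgt => /negP; apply.
apply: (@lt_le_trans _ _ (r + e)); first by rewrite ltrDl.
apply: (cvgr_to_ge eU); apply: filterS (filterI Ufar (FUs _ DF)) => s -[/= /negP].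
by rewrite lee_fin -ltNge => + rs; rewrite ler0_norm ?subr_le0//; lra.
Unshelve. all: by end_near.
Qed.

End Endpoints.

Section Spectrum.
Context {R : realType} {m : nat}.
Hypothesis m2 : (2 <= m)%N.
Variable phi : 'I_m -> 'I_m -> R.
Hypothesis nonconstant : ~ exists c : R, forall i j : 'I_m, phi i j = c.

Lemma dpressure_increasing s s' : s < s' -> dpressure phi s < dpressure phi s'.
Proof. by move=> ss'; rewrite !dpressureE//; exact: gibbs_mean_increasing. Qed.

Lemma dpressure_le s s' : s <= s' -> dpressure phi s <= dpressure phi s'.
Proof.
by rewrite le_eqVlt => /predU1P[->//|/dpressure_increasing/ltW].
Qed.

Lemma dpressure_bounded : exists C, forall s, `|dpressure phi s| <= C.
Proof.
exists (\sum_i \sum_j `|phi i j|) => s; rewrite dpressureE// /gibbs_mean.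
have st := gibbs_stochastic m2 phi s.
have q0 := gibbs_frequency_ge0 m2 phi s.
apply: le_trans (ler_norm_sum _ _ _) _; apply: ler_sum => i _.
rewrite normrM ger0_norm//; apply: (@le_trans _ _ (1 * \sum_j `|phi i j|)).
  apply: ler_pM => //.
    rewrite -(sum_frequency st) [leRHS](bigD1 i)//=.
    by rewrite lerDl sumr_ge0// => k _; exact: q0.
  apply: le_trans (ler_norm_sum _ _ _) _; apply: ler_sum => j _.
  case: st => _ _ p0 p1; rewrite normrM ger0_norm// ler_piMl//.
  by rewrite -(p1 i) (bigD1 j)//= lerDl sumr_ge0.
by rewrite mul1r.
Qed.

Let range_neq0 : range (dpressure phi) !=set0.
Proof. by exists (dpressure phi 0), 0. Qed.

Let range_ub : has_ubound (range (dpressure phi)).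
Proof.
have [C hC] := dpressure_bounded; exists C => _ [s _ <-].
exact: le_trans (ler_norm _) (hC s).
Qed.

Let range_lb : has_lbound (range (dpressure phi)).
Proof.
have [C hC] := dpressure_bounded; exists (- C) => _ [s _ <-].
by have := hC s; rewrite ler_norml => /andP[].
Qed.

Lemma dpressure_cvg_pinfty :
  dpressure phi s @[s --> +oo] --> sup (range (dpressure phi)).
Proof.
move: dpressure_le range_ub; move: (dpressure phi) => f.
exact: nondecreasing_cvgr.
Qed.

Lemma dpressure_cvg_ninfty :
  dpressure phi s @[s --> -oo] --> inf (range (dpressure phi)).
Proof.
apply/cvgrPdist_le => e e0.
have [_ [s0 _ <-] hs0] := inf_adherent e0 (conj range_neq0 range_lb).
near=> s.
have ss0 : s <= s0 by near: s; apply: nbhs_ninfty_le; exact: num_real.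
rewrite ler0_norm; last first.
  by rewrite subr_le0; apply: ge_inf => //; exists s.
by rewrite opprB lerBlDl (le_trans (dpressure_le ss0))// ltW.
Unshelve. all: by end_near.
Qed.

Lemma dpressure_pinftyE : dpressure_pinfty phi = sup (range (dpressure phi)).
Proof. exact/cvg_lim/dpressure_cvg_pinfty. Qed.

Lemma dpressure_ninftyE : dpressure_ninfty phi = inf (range (dpressure phi)).
Proof. exact/cvg_lim/dpressure_cvg_ninfty. Qed.

Lemma dpressure_surjective alpha :
  dpressure_ninfty phi < alpha < dpressure_pinfty phi ->
  exists s, dpressure phi s = alpha.
Proof.
rewrite dpressure_pinftyE dpressure_ninftyE => /andP[lo hi].
have [_ [s1 _ <-] h1] := inf_lt range_neq0 lo.
have [_ [s2 _ <-] h2] := sup_gt range_neq0 hi.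
have s12 : s1 <= s2.
  rewrite leNgt; apply/negP => /dpressure_increasing.
  by rewrite ltNge (ltW (lt_trans h1 h2)).
have ct : continuous (dpressure phi).
  have -> : dpressure phi = gibbs_mean phi by apply/funext => s; exact: dpressureE.
  by move=> s; exact: gibbs_mean_continuous.
have [|s _ <-] := IVT s12 (continuous_subspaceT ct) (v := alpha); last by exists s.
have le12 := dpressure_le s12.
by rewrite (min_idPl le12) (max_idPr le12) (ltW h1) (ltW h2).
Qed.

End Spectrum.

Theorem theorem3p1 (R : realType) (m : nat) (phi : 'I_m -> 'I_m -> R)
    (hm : (2 <= m)%N)
    (hphi : ~ exists c : R, forall i j : 'I_m, phi i j = c)
    (alpha : R)
    (halpha : dpressure_ninfty phi <= alpha <= dpressure_pinfty phi) :
  [/\ dpressure_ninfty phi < alpha < dpressure_pinfty phi ->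
        exists s : R,
          unique (fun s' : R => dpressure phi s' = alpha) s /\
          hausdorff_dim (level_set phi alpha) = (dim_formula phi s)%:E,
      alpha = dpressure_ninfty phi ->
        (dim_formula phi s)%:E @[s --> -oo]
          --> hausdorff_dim (level_set phi alpha)
    & alpha = dpressure_pinfty phi ->
        (dim_formula phi s)%:E @[s --> +oo]
          --> hausdorff_dim (level_set phi alpha)].
Proof.
split.
- move=> /(dpressure_surjective hm hphi)[s <-]; exists s; split; last first.
    exact: level_set_dim_eq.
  split=> [|s' ss']; first exact: erefl.
  have neq u v : dpressure phi u = dpressure phi v -> ~~ (u < v).
    move=> uv; apply/negP => /(dpressure_increasing hm hphi).
    by rewrite uv ltxx.
  by apply: le_anti; rewrite !leNgt (neq _ _ ss') (neq _ _ (esym ss')).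
- move=> ->; apply: level_set_dim_cvg => //.
    by rewrite dpressure_ninftyE//; exact: dpressure_cvg_ninfty.
  near=> s; have s0 : s <= 0 by near: s; apply: nbhs_ninfty_le; exact: num_real.
  rewrite mulr_le0// subr_le0 dpressure_ninftyE//; apply: ge_inf.
    by have [C hC] := dpressure_bounded hm phi; exists (- C) => _ [u _ <-];
      have := hC u; rewrite ler_norml => /andP[].
  by exists s.
- move=> ->; apply: level_set_dim_cvg => //.
    by rewrite dpressure_pinftyE//; exact: dpressure_cvg_pinfty.
  near=> s; have s0 : 0 <= s by near: s; apply: nbhs_pinfty_ge; exact: num_real.
  rewrite mulr_ge0// subr_ge0 dpressure_pinftyE//; apply: ub_le_sup.
    by have [C hC] := dpressure_bounded hm phi; exists C => _ [u _ <-];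
      exact: le_trans (ler_norm _) (hC u).
  by exists s.
Unshelve. all: by end_near.
Qed.
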